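(* Let $\{F_i\}$ be a sequence of finite dimensional Banach spaces. Let $X_1=\ell_p(F_i)$ be the $\ell_p$-sum of $\{F_i\}$, where $p\in(1,\infty)$, and let $X_2=c_0(F_i)$ be the $c_0$-sum of $\{F_i\}$. For each $k\in\{1,2\}$, if $n(X_k)>0$, then $\mathcal{K}_v(X_k)$ is an M-ideal in $\mathcal{L}_v(X_k)$.
   Context: Banach spaces are over $\mathbb{K}=\mathbb{R}$ or $\mathbb{C}$; $B_X$ and $S_X$ denote the closed unit ball and the unit sphere of $X$. $\mathcal{L}(X)$ is the space of bounded linear operators on $X$ and $\mathcal{K}(X)$ its subspace of compact operators. Put $\Pi(X)=\{(x^*,x)\in S_{X^*}\times S_X: x^*(x)=1\}$. The numerical radius of $T\in\mathcal{L}(X)$ is $v(T)=\sup\{|x^*(Tx)|:(x^*,x)\in\Pi(X)\}$, and the numerical index of $X$ is $n(X)=\inf\{v(T):T\in\mathcal{L}(X),\ \|T\|=1\}$. If $n(X)>0$, then $v$ is a norm on $\mathcal{L}(X)$ equivalent to the operator norm; $\mathcal{L}_v(X)$ and $\mathcal{K}_v(X)$ denote $\mathcal{L}(X)$ and $\mathcal{K}(X)$ equipped with the norm $v$. A closed subspace $J$ of a Banach space $Z$ is an M-ideal in $Z$ if $Z^*=J^*\oplus_1 J^\perp$, i.e. the annihilator $J^\perp$ is the kernel of a linear projection $P$ on $Z^*$ with $\|z^*\|=\|Pz^*\|+\|z^*-Pz^*\|$ for all $z^*\in Z^*$ (the range of $P$ then being identified isometrically with $J^*$). *)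

(* Defs.v *)
From HB Require Import structures.
From mathcomp Require Import all_boot all_order all_algebra.
From mathcomp Require Import complex.
From mathcomp Require Import all_classical all_reals all_analysis.

Set Implicit Arguments.
Unset Strict Implicit.
Unset Printing Implicit Defensive.

Import Order.TTheory GRing.Theory Num.Theory.
Import numFieldNormedType.Exports.

Local Open Scope classical_set_scope.
Local Open Scope ring_scope.

Inductive scalar_kind := RealScalars | ComplexScalars.

Definition scalars (R : realType) (k : scalar_kind) : numFieldType :=
  match k with RealScalars => R | ComplexScalars => R[i] end.

Definition real_part (R : realType) (k : scalar_kind) : scalars R k -> R :=
  match k with RealScalars => fun x => x | ComplexScalars => @complex.Re R end.

Definition of_real (R : realType) (k : scalar_kind) : R -> scalars R k :=
  match k with RealScalars => fun x => x | ComplexScalars => fun x => x%:C%C end.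
Arguments of_real {R k} x.

Section scalars_theory.
Context {R : realType} {k : scalar_kind}.
Local Notation K := (scalars R k).

Lemma of_realK (x : R) : real_part (of_real x : K) = x.
Proof. by case: k. Qed.

Lemma real_partK (z : K) : 0 <= z -> of_real (real_part z) = z.
Proof.
case: k z => //= -[a b]; rewrite lecE /= => /andP[/eqP -> _].
by [].
Qed.

Lemma le_of_real (x y : R) : (of_real x <= of_real y :> K) = (x <= y).
Proof. by case: k => //=; rewrite lecE /= eqxx. Qed.

Lemma of_realD (x y : R) : of_real (x + y) = of_real x + of_real y :> K.
Proof. by case: k => //=; rewrite raddfD. Qed.

Lemma of_realM (x y : R) : of_real (x * y) = of_real x * of_real y :> K.
Proof. by case: k => //=; rewrite rmorphM. Qed.

Lemma of_real0 : of_real 0 = 0 :> K. Proof. by case: k. Qed.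

Lemma of_real1 : of_real 1 = 1 :> K. Proof. by case: k. Qed.

Lemma of_real_eq0 (x : R) : of_real x = 0 :> K -> x = 0.
Proof. by move=> x0; rewrite -(of_realK x) x0 -of_real0 of_realK. Qed.

Lemma real_part_ge0 (z : K) : 0 <= z -> 0 <= real_part z.
Proof. by move=> z0; rewrite -le_of_real of_real0 real_partK. Qed.

Lemma real_part_le (y z : K) : 0 <= y -> y <= z -> real_part y <= real_part z.
Proof. by move=> y0 yz; rewrite -le_of_real !real_partK// (le_trans y0). Qed.

Lemma real_partM (y z : K) : 0 <= y -> 0 <= z ->
  real_part (y * z) = real_part y * real_part z.
Proof.
move=> y0 z0; have := of_realM (real_part y) (real_part z).
by rewrite !real_partK// => <-; rewrite of_realK.
Qed.

Lemma real_partD (y z : K) : 0 <= y -> 0 <= z ->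
  real_part (y + z) = real_part y + real_part z.
Proof.
move=> y0 z0; have := of_realD (real_part y) (real_part z).
by rewrite !real_partK// => <-; rewrite of_realK.
Qed.

End scalars_theory.

(* The library's norm [`|x|] takes its values in the scalar field; [rnorm x] is
   the same number as an element of [R]. *)
Definition rnorm {R : realType} {k : scalar_kind}
  {V : normedModType (scalars R k)} (x : V) : R := real_part `|x|.

Section rnorm_theory.
Context {R : realType} {k : scalar_kind}.
Local Notation K := (scalars R k).
Context {V : normedModType K}.
Implicit Types x y : V.

Lemma rnormE x : of_real (rnorm x) = `|x|.
Proof. exact: real_partK. Qed.

Lemma rnorm_ge0 x : 0 <= rnorm x.
Proof. exact: real_part_ge0. Qed.

Lemma rnorm0 : rnorm (0 : V) = 0.
Proof. by rewrite /rnorm normr0 -of_real0 of_realK. Qed.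

Lemma rnorm_eq0 x : rnorm x = 0 -> x = 0.
Proof. by move=> x0; apply/normr0_eq0; rewrite -rnormE x0 of_real0. Qed.

Lemma rnormD x y : rnorm (x + y) <= rnorm x + rnorm y.
Proof. by rewrite -real_partD//; apply: real_part_le => //; exact: ler_normD. Qed.

Lemma rnormZ (l : K) x : rnorm (l *: x) = rnorm (l : K^o) * rnorm x.
Proof. by rewrite /rnorm normrZ real_partM. Qed.

End rnorm_theory.

Section sup_image.
Context {R : realType} {I : Type}.
Implicit Types (P : set I) (f : I -> R).

Lemma sup_image_le P f (M : R) : 0 <= M ->
  (forall i, P i -> f i <= M) -> sup [set f i | i in P] <= M.
Proof.
move=> M0 fM; have [->|P0] := eqVneq P set0; first by rewrite image_set0 sup0.
apply: ge_sup; last by move=> _ [i Pi <-]; exact: fM.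
by apply/image_nonempty/set0P.
Qed.

Lemma sup_image_ub P f (M : R) (i : I) :
  (forall i, P i -> f i <= M) -> P i -> f i <= sup [set f i | i in P].
Proof.
move=> fM Pi; apply: ub_le_sup; last by exists i.
by exists M => _ [j Pj <-]; exact: fM.
Qed.

Lemma sup_image_ge0 P f : (forall i, 0 <= f i) -> 0 <= sup [set f i | i in P].
Proof.
move=> f0; have [->|/set0P[i Pi]] := eqVneq P set0.
  by rewrite image_set0 sup0.
have [hs|hs] := pselect (has_sup [set f i | i in P]); last first.
  by rewrite (sup_out hs).
by apply: (le_trans (f0 i)); apply: sup_upper_bound => //; exists i.
Qed.

End sup_image.

Section scaling.
Context {R : realType} {k : scalar_kind}.
Local Notation K := (scalars R k).

Lemma subhomogeneous_eq (V : lmodType K) (N : V -> R) :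
  (forall l x, N (l *: x) <= rnorm (l : K^o) * N x) ->
  forall l x, N (l *: x) = rnorm (l : K^o) * N x.
Proof.
move=> NZ l x; apply/eqP; rewrite eq_le NZ /=.
have [->|l0] := eqVneq l 0.
  have -> : rnorm (0 : K^o) = 0 :> R by exact: rnorm0.
  rewrite mul0r scale0r.
  have := NZ 0 x; rewrite scale0r; have := NZ 2 0; rewrite scaler0.
  have -> : rnorm (2 : K^o) = 2 :> R.
    by rewrite /rnorm ger0_norm// mulr2n real_partD// -of_real1 of_realK.
  by rewrite mulr_natl mulr2n lerDl.
have l1 : 0 < rnorm (l : K^o).
  rewrite lt_neqAle rnorm_ge0 andbT eq_sym.
  by apply/negP => /eqP/(@rnorm_eq0 _ _ (K^o)) l00; rewrite l00 eqxx in l0.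
have := NZ l^-1 (l *: x); rewrite scalerA mulVf// scale1r.
have := @rnormZ _ _ (K^o) l^-1 (l : K^o).
rewrite /GRing.scale /= mulVf//.
have -> : rnorm (1 : K^o) = 1 :> R.
  by rewrite /rnorm normr1 -of_real1 of_realK.
move=> e /(ler_wpM2l (ltW l1)); rewrite mulrA (mulrC (rnorm (l : K^o)) (rnorm _)).
by rewrite -e mul1r.
Qed.

End scaling.

Section bounded_operators.
Context {R : realType} {k : scalar_kind}.
Local Notation K := (scalars R k).
Variables (V W : normedModType K).

Definition is_bounded_operator (T : V -> W) : Prop :=
  linear T /\ exists M : R, forall x, rnorm (T x) <= M * rnorm x.

Definition bounded_operator_pred : {pred V -> W} :=
  fun T => `[< is_bounded_operator T >].

Lemma bounded_operator_closed : submod_closed bounded_operator_pred.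
Proof.
split=> [|l S T /asboolP[linS [M SM]] /asboolP[linT [N TN]]].
- apply/asboolP; split.
    by move=> l x y; rewrite /GRing.zero /= scaler0 addr0.
  by exists 0 => x; rewrite mul0r rnorm0.
- apply/asboolP; split.
    move=> a x y; rewrite -[LHS]/(l *: S (a *: x + y) + T (a *: x + y)).
    rewrite linS linT -[RHS]/(a *: (l *: S x + T x) + (l *: S y + T y)).
    rewrite !scalerDr !scalerA (mulrC l) addrACA.
    by [].
  exists (rnorm (l : K^o) * M + N) => x.
  rewrite mulrDl (le_trans (rnormD _ _))// lerD// rnormZ -mulrA.
  by rewrite ler_wpM2l// rnorm_ge0.
Qed.

HB.instance Definition _ := GRing.isSubmodClosed.Build K (V -> W)
  bounded_operator_pred bounded_operator_closed.

Record bounded_operator : Type := BoundedOperator {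
  operator_fun :> V -> W;
  operator_prop : operator_fun \in bounded_operator_pred }.

HB.instance Definition _ := [isSub for operator_fun].
HB.instance Definition _ := [Choice of bounded_operator by <:].
HB.instance Definition _ := [SubChoice_isSubLmodule of bounded_operator by <:].

Lemma bounded_operator_linear (T : bounded_operator) : linear T.
Proof. by case: T => T /= /asboolP[]. Qed.

HB.instance Definition _ (T : bounded_operator) :=
  GRing.isLinear.Build K V W *:%R (operator_fun T) (bounded_operator_linear T).

Definition operator_rnorm (T : bounded_operator) : R :=
  sup [set rnorm (T x) | x in [set x : V | `|x| <= 1]].

Lemma operator_bounded (T : bounded_operator) :
  exists M, forall x, `|x| <= 1 -> rnorm (T x) <= M.
Proof.
case: T => T /= /asboolP[_ [M TM]]; exists `|M| => x x1.
rewrite (le_trans (TM x))// (@le_trans _ _ (`|M| * rnorm x))//.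
  by rewrite ler_wpM2r// ?rnorm_ge0// ler_norm.
by rewrite ler_piMr// -(@le_of_real R k) rnormE of_real1.
Qed.

Lemma operator_rnorm_ub (T : bounded_operator) x :
  `|x| <= 1 -> rnorm (T x) <= operator_rnorm T.
Proof.
have [M TM] := operator_bounded T => x1.
exact: (@sup_image_ub R V [set x : V | `|x| <= 1] (fun x => rnorm (T x)) M).
Qed.

Lemma operator_rnorm_ge0 (T : bounded_operator) : 0 <= operator_rnorm T.
Proof. by apply: sup_image_ge0 => x; exact: rnorm_ge0. Qed.

Lemma operator_rnormD (S T : bounded_operator) :
  operator_rnorm (S + T) <= operator_rnorm S + operator_rnorm T.
Proof.
apply: sup_image_le => [|x x1]; first by rewrite addr_ge0// operator_rnorm_ge0.
by rewrite (le_trans (rnormD _ _))// lerD// operator_rnorm_ub.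
Qed.

Lemma operator_rnormZ (l : K) (T : bounded_operator) :
  operator_rnorm (l *: T) = rnorm (l : K^o) * operator_rnorm T.
Proof.
apply: subhomogeneous_eq => {l T} l T.
apply: sup_image_le => [|x x1].
  by rewrite mulr_ge0 ?rnorm_ge0// operator_rnorm_ge0.
by rewrite -[(l *: T) x]/(l *: T x) rnormZ ler_wpM2l ?rnorm_ge0// operator_rnorm_ub.
Qed.

Lemma operator_rnorm_eq0 (T : bounded_operator) : operator_rnorm T = 0 -> T = 0.
Proof.
move=> T0; apply/val_inj/funext => x /=.
have [->|x0] := eqVneq x 0; first by rewrite linear0.
have nx0 : `|x| != 0 by rewrite normr_eq0.
have /(operator_rnorm_ub T) : `|(`|x|^-1 : K) *: x| <= 1.
  by rewrite normrZ normfV normr_id mulVf.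
rewrite T0 linearZ /= => Tx0.
have /rnorm_eq0/eqP : rnorm ((`|x|^-1 : K) *: T x) = 0.
  by apply/eqP; rewrite eq_le Tx0 rnorm_ge0.
by rewrite scaler_eq0 invr_eq0 (negPf nx0) => /eqP.
Qed.

Let operator_norm (T : bounded_operator) : K := of_real (operator_rnorm T).

Let operator_normD S T : operator_norm (S + T) <= operator_norm S + operator_norm T.
Proof. by rewrite -of_realD le_of_real operator_rnormD. Qed.

Let operator_normZ (l : K) T : operator_norm (l *: T) = `|l| * operator_norm T.
Proof. by rewrite /operator_norm operator_rnormZ of_realM (rnormE (l : K^o)). Qed.

Let operator_norm_eq0 T : operator_norm T = 0 -> T = 0.
Proof. by move/of_real_eq0/operator_rnorm_eq0. Qed.

HB.instance Definition _ := Lmodule_isNormed.Build K bounded_operator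
  operator_normD operator_normZ operator_norm_eq0.

End bounded_operators.

Definition dual (R : realType) (k : scalar_kind)
    (V : normedModType (scalars R k)) : Type :=
  bounded_operator V (scalars R k)^o.
HB.instance Definition _ (R : realType) (k : scalar_kind)
  (V : normedModType (scalars R k)) := NormedModule.on (dual V).

Definition annihilator (R : realType) (k : scalar_kind)
    (Z : normedModType (scalars R k)) (J : set Z) : set (dual Z) :=
  [set f | forall z, J z -> f z = 0].

Definition closed_subspace (R : realType) (k : scalar_kind)
    (Z : normedModType (scalars R k)) (J : set Z) : Prop :=
  [/\ J 0, forall (a : scalars R k) x y, J x -> J y -> J (a *: x + y) & closed J].

(* [Z^* = J^* (+)_1 J^perp] is expressed by an L-projection [P] of [dual Z] with
   kernel the annihilator of [J]. *)
Definition M_ideal (R : realType) (k : scalar_kind)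
    (Z : normedModType (scalars R k)) (J : set Z) : Prop :=
  closed_subspace J /\
  exists P : {linear dual Z -> dual Z},
    [/\ forall f, P (P f) = P f,
        [set f | P f = 0] = annihilator J
      & forall f, `|f| = `|P f| + `|f - P f|].

Definition compact_operator (R : realType) (k : scalar_kind)
    (V W : normedModType (scalars R k)) (T : V -> W) : Prop :=
  precompact (T @` [set x : V | `|x| <= 1]).

Section numerical_index.
Context {R : realType} {k : scalar_kind}.
Local Notation K := (scalars R k).
Variable X : normedModType K.

Definition states : set (dual X * X) :=
  [set fx : dual X * X | [/\ `|fx.1| = 1, `|fx.2| = 1 & fx.1 fx.2 = 1]].

Definition numerical_radius (T : bounded_operator X X) : R :=
  sup [set rnorm (fx.1 (T fx.2)) | fx in states].

(* Valued in [\bar R] so that the infimum of the empty set is [+oo]; that case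
   only occurs for [X = {0}]. *)
Definition numerical_index : \bar R :=
  ereal_inf [set (numerical_radius T)%:E |
             T in [set T : bounded_operator X X | `|T| = 1]].

End numerical_index.

Section numerical_radius_norm.
Context {R : realType} {k : scalar_kind}.
Local Notation K := (scalars R k).
Context {X : normedModType K}.
Implicit Types S T : bounded_operator X X.

Lemma numerical_radius_bounded T (fx : dual X * X) :
  states fx -> rnorm (fx.1 (T fx.2)) <= operator_rnorm T.
Proof.
case: fx => f x [/= f1 x1 _].
have Tx : rnorm (T x) <= operator_rnorm T by apply: operator_rnorm_ub; rewrite x1.
apply: le_trans Tx.
have [->|Tx0] := eqVneq (T x) 0; first by rewrite linear0 !rnorm0.
have nTx0 : `|T x| != 0 by rewrite normr_eq0.
have : `|(`|T x|^-1 : K) *: T x| <= 1.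
  by rewrite normrZ normfV normr_id mulVf.
move=> /(operator_rnorm_ub f).
have -> : operator_rnorm f = 1 by rewrite -(@of_realK R k (operator_rnorm f))
  -[of_real _]/`|f| f1 -of_real1 of_realK.
rewrite -(@le_of_real R k) rnormE of_real1 linearZ /= normrZ normfV normr_id.
by rewrite ler_pdivrMl ?normr_gt0// mulr1 -(@le_of_real R k) !rnormE.
Qed.

Lemma numerical_radius_ub T (fx : dual X * X) :
  states fx -> rnorm (fx.1 (T fx.2)) <= numerical_radius T.
Proof.
apply: (@sup_image_ub R _ (@states R k X)
  (fun fx => rnorm (fx.1 (T fx.2))) (operator_rnorm T)).
exact: numerical_radius_bounded.
Qed.

Lemma numerical_radius_ge0 T : 0 <= numerical_radius T.
Proof. by apply: sup_image_ge0 => fx; exact: rnorm_ge0. Qed.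

Lemma numerical_radiusD S T :
  numerical_radius (S + T) <= numerical_radius S + numerical_radius T.
Proof.
apply: sup_image_le => [|fx sfx]; first by rewrite addr_ge0// numerical_radius_ge0.
rewrite -[(S + T) fx.2]/(S fx.2 + T fx.2) linearD (le_trans (rnormD _ _))//.
by rewrite lerD// numerical_radius_ub.
Qed.

Lemma numerical_radiusZ (l : K) T :
  numerical_radius (l *: T) = rnorm (l : K^o) * numerical_radius T.
Proof.
apply: subhomogeneous_eq => {l T} l T.
apply: sup_image_le => [|fx sfx].
  by rewrite mulr_ge0 ?rnorm_ge0// numerical_radius_ge0.
rewrite -[(l *: T) fx.2]/(l *: T fx.2) linearZ rnormZ.
by rewrite ler_wpM2l ?rnorm_ge0// numerical_radius_ub.
Qed.

Lemma numerical_radius_eq0 T : (0 < numerical_index X)%E ->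
  numerical_radius T = 0 -> T = 0.
Proof.
move=> n0 vT0; apply/eqP/negPn/negP => T0.
have nT0 : `|T| != 0 by rewrite normr_eq0.
have : (numerical_index X <= (numerical_radius ((`|T|^-1 : K) *: T))%:E)%E.
  apply: ereal_inf_lbound; exists ((`|T|^-1 : K) *: T) => //=.
  by rewrite normrZ normfV normr_id mulVf.
by rewrite numerical_radiusZ vT0 mulr0 => /(lt_le_trans n0); rewrite ltxx.
Qed.

End numerical_radius_norm.

(* A copy of [bounded_operator X X] normed by the numerical radius [v], which is
   a norm only when [n(X) > 0]. *)
Definition Lv (R : realType) (k : scalar_kind) (X : normedModType (scalars R k))
  (nX : (0 < numerical_index X)%E) : Type := bounded_operator X X.

Section Lv_norm.
Context {R : realType} {k : scalar_kind}.
Local Notation K := (scalars R k).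
Variables (X : normedModType K) (nX : (0 < numerical_index X)%E).

HB.instance Definition _ := GRing.Lmodule.on (Lv nX).

Let Lv_norm (T : Lv nX) : K := of_real (numerical_radius T).

Let Lv_normD (S T : Lv nX) : Lv_norm (S + T) <= Lv_norm S + Lv_norm T.
Proof. by rewrite -of_realD le_of_real numerical_radiusD. Qed.

Let Lv_normZ (l : K) (T : Lv nX) : Lv_norm (l *: T) = `|l| * Lv_norm T.
Proof. by rewrite /Lv_norm numerical_radiusZ of_realM (rnormE (l : K^o)). Qed.

Let Lv_norm_eq0 (T : Lv nX) : Lv_norm T = 0 -> T = 0.
Proof. by move/of_real_eq0/(numerical_radius_eq0 nX). Qed.

HB.instance Definition _ := Lmodule_isNormed.Build K (Lv nX)
  Lv_normD Lv_normZ Lv_norm_eq0.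

End Lv_norm.

Definition Kv (R : realType) (k : scalar_kind) (X : normedModType (scalars R k))
    (nX : (0 < numerical_index X)%E) : set (Lv nX) :=
  [set T | compact_operator (T : bounded_operator X X)].
Arguments Kv {R k X} nX.

Definition finite_dimensional (K : numFieldType) (V : lmodType K) : Prop :=
  exists (n : nat) (e : 'I_n -> V),
    forall x, exists c : 'I_n -> K, x = \sum_(i < n) c i *: e i.

Definition vector_sequence (R : realType) (k : scalar_kind)
  (F : nat -> completeNormedModType (scalars R k)) : Type := forall i, F i.

Section vector_sequence_lmodule.
Context {R : realType} {k : scalar_kind}.
Local Notation K := (scalars R k).
Variable F : nat -> completeNormedModType K.
Local Notation T := (vector_sequence F).

HB.instance Definition _ := Choice.copy T (forall i, F i).

Let zero : T := fun=> 0.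
Let opp (x : T) : T := fun i => - x i.
Let add (x y : T) : T := fun i => x i + y i.
Let scale (l : K) (x : T) : T := fun i => l *: x i.

Let addA : associative add.
Proof. by move=> x y z; apply: functional_extensionality_dep => i; rewrite /add addrA. Qed.
Let addC : commutative add.
Proof. by move=> x y; apply: functional_extensionality_dep => i; rewrite /add addrC. Qed.
Let add0 : left_id zero add.
Proof. by move=> x; apply: functional_extensionality_dep => i; rewrite /add add0r. Qed.
Let addN : left_inverse zero opp add.
Proof. by move=> x; apply: functional_extensionality_dep => i; rewrite /add addNr. Qed.

HB.instance Definition _ := GRing.isZmodule.Build T addA addC add0 addN.

Let scaleA (a b : K) (x : T) : scale a (scale b x) = scale (a * b) x.
Proof. by apply: functional_extensionality_dep => i; rewrite /scale scalerA. Qed.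
Let scale1 : left_id 1 scale.
Proof. by move=> x; apply: functional_extensionality_dep => i; rewrite /scale scale1r. Qed.
Let scaleD : right_distributive scale +%R.
Proof. by move=> a x y; apply: functional_extensionality_dep => i; exact: scalerDr. Qed.
Let scaleDl (x : T) : {morph scale^~ x : a b / a + b}.
Proof. by move=> a b; apply: functional_extensionality_dep => i; exact: scalerDl. Qed.

HB.instance Definition _ := GRing.Zmodule_isLmodule.Build K T
  scaleA scale1 scaleD scaleDl.

End vector_sequence_lmodule.

Definition lp_series (R : realType) (k : scalar_kind) (p : R)
    (F : nat -> completeNormedModType (scalars R k))
    (x : vector_sequence F) : \bar R :=
  \sum_(0 <= i <oo) ((rnorm (x i)) `^ p)%:E.

(* The proof of [1 < p] is an argument so that the normed space structure of
   [lp_sum], which depends on it, can be inferred. *)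
Definition lp_pred (R : realType) (k : scalar_kind) (p : R) of 1 < p :=
  fun (F : nat -> completeNormedModType (scalars R k)) (x : vector_sequence F) =>
    `[< (lp_series p x < +oo)%E >].

Section lp_sum.
Context {R : realType} {k : scalar_kind}.
Local Notation K := (scalars R k).
Context {p : R}.
Variables (p1 : 1 < p) (F : nat -> completeNormedModType K).
Local Notation lp_series := (@lp_series R k p F).
Local Notation lp_pred := (lp_pred p1 (F := F)).

Let p0 : 0 < p. Proof. exact: lt_trans p1. Qed.

Lemma lp_series_ge0 (x : vector_sequence F) : (0 <= lp_series x)%E.
Proof. by apply: nneseries_ge0 => i _ _; rewrite lee_fin powR_ge0. Qed.

Lemma lp_seriesZ (l : K) (x : vector_sequence F) :
  lp_series (l *: x) = ((rnorm (l : K^o) `^ p)%:E * lp_series x)%E.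
Proof.
rewrite /lp_series -nneseriesZl; last by move=> i _; rewrite lee_fin powR_ge0.
apply: eq_eseriesr => i _; rewrite -EFinM -powRM ?rnorm_ge0//.
by rewrite -[(l *: x) i]/(l *: x i) rnormZ.
Qed.

Let powR_convex (w a b : R) : 0 <= w -> w <= 1 -> 0 <= a -> 0 <= b ->
  (w * a + (1 - w) * b) `^ p <= w * a `^ p + (1 - w) * b `^ p.
Proof.
move=> w0 w1 a0 b0.
by apply: (convex_powR (ltW p1) (Itv01 w0 w1)); rewrite !inE/= in_itv/= ?a0 ?b0.
Qed.

Lemma lp_series_convex (w : R) (x y : vector_sequence F) : 0 <= w -> w <= 1 ->
  (lp_series ((of_real w : K) *: x + (of_real (1 - w) : K) *: y)%R <=
   w%:E * lp_series x + (1 - w)%R%:E * lp_series y)%E.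
Proof.
move=> w0 w1; have w10 : 0 <= 1 - w by rewrite subr_ge0.
rewrite /lp_series.
rewrite -!nneseriesZl; [|by move=> i _; rewrite lee_fin powR_ge0..].
rewrite -nneseriesD; last 2 first.
- by move=> i _ _; rewrite -EFinM lee_fin mulr_ge0 ?powR_ge0.
- by move=> i _ _; rewrite -EFinM lee_fin mulr_ge0 ?powR_ge0.
apply: lee_nneseries => [i _ _|i _]; first by rewrite lee_fin powR_ge0.
rewrite -!EFinM -EFinD lee_fin.
rewrite (le_trans _ (powR_convex w0 w1 (rnorm_ge0 _) (rnorm_ge0 _)))//.
rewrite ge0_ler_powR ?nnegrE ?addr_ge0 ?mulr_ge0 ?rnorm_ge0//; first exact: ltW.
rewrite (le_trans (rnormD _ _))// !rnormZ /rnorm !ger0_norm -?of_real0 ?le_of_real//.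
by rewrite !of_realK.
Qed.

Lemma lp_seriesZr (a : R) (x : vector_sequence F) : 0 <= a ->
  lp_series ((of_real a : K) *: x) = ((a `^ p)%:E * lp_series x)%E.
Proof.
by move=> a0; rewrite lp_seriesZ /rnorm ger0_norm ?of_realK// -of_real0 le_of_real.
Qed.

Let lp_predZ (l : K) (x : vector_sequence F) :
  (lp_series x < +oo)%E -> (lp_series (l *: x)%R < +oo)%E.
Proof.
by move=> x_fin; rewrite lp_seriesZ lte_mul_pinfty// lee_fin powR_ge0.
Qed.

Let lp_predD (x y : vector_sequence F) :
  (lp_series x < +oo)%E -> (lp_series y < +oo)%E -> (lp_series (x + y)%R < +oo)%E.
Proof.
move=> x_fin y_fin.
have h0 : (0 : R) <= 2^-1 by rewrite invr_ge0.
have h1 : (2^-1 : R) <= 1 by rewrite invf_le1// ler1n.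
have h2 : (1 - 2^-1 : R) = 2^-1 by rewrite [X in X - _](splitr 1) div1r addrK.
have -> : x + y = (of_real 2 : K) *: ((of_real 2^-1 : K) *: x + (of_real (1 - 2^-1) : K) *: y).
  by rewrite h2 -scalerDr scalerA -of_realM divff// of_real1 scale1r.
apply: lp_predZ; apply: (le_lt_trans (lp_series_convex _ _ h0 h1)).
by rewrite lte_add_pinfty// lte_mul_pinfty// lee_fin ?h2.
Qed.

Let lp_closed : submod_closed lp_pred.
Proof.
split=> [|l x y /asboolP x_fin /asboolP y_fin]; apply/asboolP.
  rewrite -(scale0r (0 : vector_sequence F)) lp_seriesZ.
  have -> : rnorm (0 : K^o) = 0 :> R by exact: rnorm0.
  by rewrite powR0 ?mul0e// gt_eqF.
by apply: lp_predD => //; exact: lp_predZ.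
Qed.

HB.instance Definition _ := GRing.isSubmodClosed.Build K (vector_sequence F)
  lp_pred lp_closed.

Record lp_sum : Type := LpSum {
  lp_val :> vector_sequence F;
  lp_prop : lp_val \in lp_pred }.

HB.instance Definition _ := [isSub for lp_val].
HB.instance Definition _ := [Choice of lp_sum by <:].
HB.instance Definition _ := [SubChoice_isSubLmodule of lp_sum by <:].

Definition lp_rnorm (x : lp_sum) : R := fine (lp_series x) `^ p^-1.

Lemma lp_series_fin (x : lp_sum) : lp_series x \is a fin_num.
Proof.
rewrite ge0_fin_numE ?lp_series_ge0//.
by case: x => x /= /asboolP.
Qed.

Lemma lp_rnorm_ge0 (x : lp_sum) : 0 <= lp_rnorm x.
Proof. exact: powR_ge0. Qed.

Lemma lp_rnormE (x : lp_sum) : lp_series x = (lp_rnorm x `^ p)%:E.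
Proof.
rewrite /lp_rnorm -powRrM mulVf ?gt_eqF// powRr1 ?fine_ge0 ?lp_series_ge0//.
by rewrite fineK ?lp_series_fin.
Qed.

Lemma lp_rnorm_le (x : lp_sum) (M : R) : 0 <= M ->
  (lp_series x <= (M `^ p)%:E)%E -> lp_rnorm x <= M.
Proof.
move=> M0; rewrite lp_rnormE lee_fin.
move: (lp_rnorm x) (lp_rnorm_ge0 x) => r r0 rM.
have : (r `^ p) `^ p^-1 <= (M `^ p) `^ p^-1.
  by rewrite ge0_ler_powR ?nnegrE ?powR_ge0// invr_ge0 ltW.
by rewrite -!powRrM divff ?gt_eqF// !powRr1.
Qed.

Lemma lp_rnorm_eq0 (x : lp_sum) : lp_rnorm x = 0 -> x = 0.
Proof.
move=> x0; apply/val_inj/functional_extensionality_dep => i /=.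
have Sx0 : (lp_series x = 0)%E by rewrite lp_rnormE x0 powR0// gt_eqF.
have : (((rnorm (lp_val x i)) `^ p)%:E <= 0)%E.
  rewrite -Sx0; apply: le_trans (nneseries_lim_ge i.+1 _); last first.
    by move=> n _ _; rewrite lee_fin powR_ge0.
  rewrite big_nat_recr//= leeDr// sume_ge0// => n _.
  by rewrite lee_fin powR_ge0.
rewrite lee_fin => /(conj (powR_ge0 (rnorm (lp_val x i)) p))/andP/le_anti/esym/eqP.
by rewrite powR_eq0 (gt_eqF p0) andbT => /eqP/rnorm_eq0.
Qed.

Lemma lp_minkowski (s t : R) (x y : vector_sequence F) : 0 < s -> 0 < t ->
  lp_series x = (s `^ p)%:E -> lp_series y = (t `^ p)%:E ->
  (lp_series (x + y)%R <= ((s + t) `^ p)%:E)%E.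
Proof.
move=> s0 t0 xs yt; have st0 : 0 < s + t by exact: addr_gt0.
have w0 : 0 <= s / (s + t) by rewrite divr_ge0// ltW.
have w1 : s / (s + t) <= 1 by rewrite ler_pdivrMr// mul1r lerDl ltW.
have w1E : 1 - s / (s + t) = t / (s + t).
  by rewrite -(divff (lt0r_neq0 st0)) -mulrBl addrAC subrr add0r.
have -> : x + y = (of_real (s + t) : K) *:
    ((of_real (s / (s + t)) : K) *: ((of_real s^-1 : K) *: x) +
     (of_real (1 - s / (s + t)) : K) *: ((of_real t^-1 : K) *: y)).
  have E u : u != 0 -> (s + t) * (u / (s + t) * u^-1) = 1.
    by move=> u0; rewrite mulrAC divff// mul1r divff// gt_eqF.
  rewrite scalerDr !scalerA -!of_realM w1E -!mulrA !(mulrA _ (s + t)^-1).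
  by rewrite !E ?gt_eqF// of_real1 !scale1r.
rewrite lp_seriesZr ?(ltW st0)// -[leRHS]mule1 lee_wpmul2l// ?lee_fin ?powR_ge0//.
apply: (le_trans (lp_series_convex _ _ w0 w1)).
have unit_series (u : R) (z : vector_sequence F) : 0 < u ->
    lp_series z = (u `^ p)%:E -> lp_series ((of_real u^-1 : K) *: z) = 1%E.
  move=> u0 zu; rewrite lp_seriesZr ?invr_ge0 ?(ltW u0)// zu -EFinM.
  by rewrite -powRM ?invr_ge0 ?(ltW u0)// mulVf ?gt_eqF// powR1.
by rewrite (unit_series s)// (unit_series t)// !mule1 -EFinD lee_fin addrC subrK.
Qed.

Lemma lp_rnormD (x y : lp_sum) : lp_rnorm (x + y) <= lp_rnorm x + lp_rnorm y.
Proof.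
have [x0|x0] := eqVneq (lp_rnorm x) 0.
  by rewrite x0 add0r (lp_rnorm_eq0 x0) add0r.
have [y0|y0] := eqVneq (lp_rnorm y) 0.
  by rewrite y0 addr0 (lp_rnorm_eq0 y0) addr0.
apply: (@lp_rnorm_le (x + y)); first by rewrite addr_ge0 ?lp_rnorm_ge0.
apply: (@lp_minkowski _ _ (lp_val x) (lp_val y)).
- by rewrite lt_neqAle eq_sym x0 lp_rnorm_ge0.
- by rewrite lt_neqAle eq_sym y0 lp_rnorm_ge0.
- exact: lp_rnormE.
- exact: lp_rnormE.
Qed.

Lemma lp_rnormZ (l : K) (x : lp_sum) :
  lp_rnorm (l *: x) = rnorm (l : K^o) * lp_rnorm x.
Proof.
apply: subhomogeneous_eq => {l x} l x.
apply: lp_rnorm_le; first by rewrite mulr_ge0 ?rnorm_ge0// lp_rnorm_ge0.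
by rewrite -[lp_val _]/(l *: lp_val x) lp_seriesZ lp_rnormE -EFinM powRM
  ?rnorm_ge0 ?lp_rnorm_ge0.
Qed.

Let lp_norm (x : lp_sum) : K := of_real (lp_rnorm x).

Let lp_normD (x y : lp_sum) : lp_norm (x + y) <= lp_norm x + lp_norm y.
Proof. by rewrite -of_realD le_of_real lp_rnormD. Qed.

Let lp_normZ (l : K) (x : lp_sum) : lp_norm (l *: x) = `|l| * lp_norm x.
Proof. by rewrite /lp_norm lp_rnormZ of_realM (rnormE (l : K^o)). Qed.

Let lp_norm_eq0 (x : lp_sum) : lp_norm x = 0 -> x = 0.
Proof. by move/of_real_eq0/lp_rnorm_eq0. Qed.

HB.instance Definition _ := Lmodule_isNormed.Build K lp_sum
  lp_normD lp_normZ lp_norm_eq0.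

End lp_sum.

Section c0_sum.
Context {R : realType} {k : scalar_kind}.
Local Notation K := (scalars R k).
Variable F : nat -> completeNormedModType K.

Definition c0_pred : {pred vector_sequence F} :=
  fun x => `[< rnorm (x i) @[i --> \oo] --> (0 : R) >].

Let c0_closed : submod_closed c0_pred.
Proof.
split=> [|l x y /asboolP x0 /asboolP y0]; apply/asboolP.
  rewrite (_ : (fun i => _) = cst 0); first exact: cvg_cst.
  by apply/funext => i; exact: rnorm0.
apply: (@squeeze_cvgr _ _ _ _ (cst 0)
    (fun i => rnorm (l : K^o) * rnorm (x i) + rnorm (y i))).
- apply: nearW => i; rewrite rnorm_ge0 /=.
  by rewrite (le_trans (rnormD _ _))// rnormZ.
- exact: cvg_cst.
- rewrite -[X in _ --> X](addr0 0) -[X in _ --> X + _](mulr0 (rnorm (l : K^o))).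
  by apply: cvgD => //; exact: cvgMr.
Qed.

HB.instance Definition _ := GRing.isSubmodClosed.Build K (vector_sequence F)
  c0_pred c0_closed.

Record c0_sum : Type := C0Sum {
  c0_val :> vector_sequence F;
  c0_prop : c0_val \in c0_pred }.

HB.instance Definition _ := [isSub for c0_val].
HB.instance Definition _ := [Choice of c0_sum by <:].
HB.instance Definition _ := [SubChoice_isSubLmodule of c0_sum by <:].

Definition c0_rnorm (x : c0_sum) : R := sup [set rnorm (c0_val x i) | i in [set: nat]].

Lemma c0_bounded (x : c0_sum) : exists M, forall i, rnorm (c0_val x i) <= M.
Proof.
case: x => x /= /asboolP x0.
have [M [_ /(_ (M + 1)) xM]] : bounded_fun (fun i => rnorm (x i)).
  by apply: cvg_seq_bounded; apply/cvg_ex; exists 0.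
exists (M + 1) => i; rewrite (le_trans (ler_norm _))//.
by apply: xM; rewrite // ltrDl.
Qed.

Lemma c0_rnorm_ub (x : c0_sum) i : rnorm (c0_val x i) <= c0_rnorm x.
Proof.
have [M xM] := c0_bounded x.
exact: (@sup_image_ub R _ [set: nat] (fun i => rnorm (c0_val x i)) M).
Qed.

Lemma c0_rnorm_ge0 (x : c0_sum) : 0 <= c0_rnorm x.
Proof. exact: le_trans (rnorm_ge0 _) (c0_rnorm_ub x 0). Qed.

Lemma c0_rnormD (x y : c0_sum) : c0_rnorm (x + y) <= c0_rnorm x + c0_rnorm y.
Proof.
apply: sup_image_le => [|i _]; first by rewrite addr_ge0// c0_rnorm_ge0.
by rewrite (le_trans (rnormD _ _))// lerD// c0_rnorm_ub.
Qed.

Lemma c0_rnormZ (l : K) (x : c0_sum) :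
  c0_rnorm (l *: x) = rnorm (l : K^o) * c0_rnorm x.
Proof.
apply: subhomogeneous_eq => {l x} l x.
apply: sup_image_le => [|i _]; first by rewrite mulr_ge0 ?rnorm_ge0// c0_rnorm_ge0.
by rewrite rnormZ ler_wpM2l ?rnorm_ge0// c0_rnorm_ub.
Qed.

Lemma c0_rnorm_eq0 (x : c0_sum) : c0_rnorm x = 0 -> x = 0.
Proof.
move=> x0; apply/val_inj/functional_extensionality_dep => i /=.
apply: rnorm_eq0; apply/eqP; rewrite eq_le rnorm_ge0 andbT -x0.
exact: (c0_rnorm_ub x i).
Qed.

Let c0_norm (x : c0_sum) : K := of_real (c0_rnorm x).

Let c0_normD (x y : c0_sum) : c0_norm (x + y) <= c0_norm x + c0_norm y.
Proof. by rewrite -of_realD le_of_real c0_rnormD. Qed.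

Let c0_normZ (l : K) (x : c0_sum) : c0_norm (l *: x) = `|l| * c0_norm x.
Proof. by rewrite /c0_norm c0_rnormZ of_realM (rnormE (l : K^o)). Qed.

Let c0_norm_eq0 (x : c0_sum) : c0_norm x = 0 -> x = 0.
Proof. by move/of_real_eq0/c0_rnorm_eq0. Qed.

HB.instance Definition _ := Lmodule_isNormed.Build K c0_sum
  c0_normD c0_normZ c0_norm_eq0.

End c0_sum.

(* Main.v *)
Require Import Defs.
From HB Require Import structures.
From mathcomp Require Import all_boot all_order all_algebra.
From mathcomp Require Import complex.
From mathcomp Require Import all_classical all_reals all_analysis.
From mathcomp Require Import ring lra.

Import Order.TTheory GRing.Theory Num.Theory.
Import numFieldNormedType.Exports.

Set Implicit Arguments.
Unset Strict Implicit.
Unset Printing Implicit Defensive.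

Local Open Scope classical_set_scope.
Local Open Scope ring_scope.

(** Let [P_n] be the projection of [X] onto its first [n] blocks and [Q_n := 1 - P_n].
    In both sums the norm of [x] is a monotone function of [|P_n x|] and [|Q_n x|].
    Everything rests on two consequences of this.

    - If [f x = 1] with [f] and [x] of norm 1, then [f o P_n] attains its norm in the
      direction of [P_n x], [f o Q_n] in the direction of [Q_n x], and the two values
      [f (P_n x)] and [f (Q_n x)] add up to 1 ([state_head_tail]).  Hence
      [v (P_n S P_n + Q_n T Q_n) <= max (v S) (v T)] ([numerical_radius_corners]).
    - As the blocks are finite-dimensional, compactness of [T] means that [Q_n T] tends
      to 0 in norm ([compact_operatorP]); then [T Q_n] tends to 0 as well, by a gliding
      hump ([compact_comp_tail]).  So [P_n T P_n] tends to [T] for compact [T]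
      ([compact_corner_cvg]), while [T - Q_n T Q_n] is compact for every [T]
      ([tail_corner_compact]).

    For a functional [f] on [L_v(X)], let [compact_part f] map [T] to the limit of
    [f (P_n T P_n)] along a fixed ultrafilter finer than the filter of cofinite sets.
    This is a linear projection; it does not change [f] on compact operators, and its
    kernel is the annihilator of [K_v(X)].  That it is an L-projection
    ([compact_part_Lnorm]) follows by evaluating [f] at [P_n S P_n + Q_n T Q_n], where
    [S] and [T] nearly norm [compact_part f] and [f - compact_part f]: the value of
    [compact_part f] at [Q_n T Q_n] is negligible, for otherwise a rotation of [T] would
    make it exceed its norm. *)

(** * Real-valued norms over both scalar fields *)

Section real_norm.
Context {R : realType} {k : scalar_kind}.
Local Notation K := (scalars R k).

Lemma rnormN (V : normedModType K) (x : V) : rnorm (- x) = rnorm x.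
Proof. by rewrite /rnorm normrN. Qed.

Lemma rnormBC (V : normedModType K) (x y : V) : rnorm (x - y) = rnorm (y - x).
Proof. by rewrite -rnormN opprB. Qed.

Lemma rnorm_triangle (V : normedModType K) (x y z : V) :
  rnorm (x - z) <= rnorm (x - y) + rnorm (y - z).
Proof. by apply: le_trans (rnormD _ _); rewrite addrA subrK. Qed.

Lemma rnorm_ge_real (a : R) : 0 <= a -> rnorm (of_real a : K^o) = a.
Proof. by move=> a0; rewrite /rnorm ger0_norm ?of_realK// -of_real0 le_of_real. Qed.

Lemma rnormZr (V : normedModType K) (a : R) (x : V) :
  0 <= a -> rnorm ((of_real a : K) *: x) = a * rnorm x.
Proof. by move=> a0; rewrite rnormZ rnorm_ge_real. Qed.

Lemma rnorm_norm (V : normedModType K) (x : V) (a : R) :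
  (`|x| <= of_real a) = (rnorm x <= a).
Proof. by rewrite -rnormE le_of_real. Qed.

Lemma rnorm_normE (V : normedModType K) (x : V) (a : R) :
  (`|x| = of_real a) <-> (rnorm x = a).
Proof. by rewrite -rnormE; split=> [/(congr1 (@real_part R k))|->//]; rewrite !of_realK. Qed.

Lemma rnormM (x y : K) : rnorm (x * y : K^o) = rnorm (x : K^o) * rnorm (y : K^o).
Proof. exact: (@rnormZ _ _ (K^o)). Qed.

Lemma real_partDE (z w : K) : real_part (z + w) = real_part z + real_part w.
Proof. by case: k z w => //= -[a b] [c d]. Qed.

Lemma real_part_le_rnorm (z : K) : real_part z <= rnorm (z : K^o).
Proof.
rewrite -(@le_of_real R k) rnormE; case: k z => /= [z|z]; first exact: ler_norm.
by apply: le_trans (normc_ge_Re z); rewrite lecR ler_norm.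
Qed.

Lemma rnorm_complex (z : R[i]) :
  @rnorm R ComplexScalars ((scalars R ComplexScalars)^o) z =
  Num.sqrt (complex.Re z ^+ 2 + complex.Im z ^+ 2).
Proof. by rewrite -[LHS]/(complex.Re `|z : R[i]|) normc_def. Qed.

(** A scalar whose real part is as large as its modulus is a nonnegative real; this is
    how equality in the triangle inequality is exploited in [state_head_tail]. *)
Lemma of_real_rnorm (z : K) : real_part z = rnorm (z : K^o) ->
  z = of_real (rnorm (z : K^o)).
Proof.
case: k z => // -[a b]; rewrite rnorm_complex /= => ab.
have a0 : 0 <= a by rewrite ab; exact: sqrtr_ge0.
rewrite -ab; move: (congr1 (fun x => x ^+ 2) ab).
rewrite sqr_sqrtr ?addr_ge0 ?sqr_ge0// => /eqP.
by rewrite -subr_eq0 opprD addrA subrr add0r oppr_eq0 sqrf_eq0 => /eqP ->.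
Qed.

Lemma exists_phase (z : K) : exists t : K,
  rnorm (t : K^o) = 1 /\ t * z = of_real (rnorm (z : K^o)).
Proof.
have [->|z0] := eqVneq z 0.
  exists 1; rewrite mulr0 /= (@rnorm0 R k (K^o)) of_real0; split=> //.
  by rewrite /rnorm normr1 -of_real1 of_realK.
exists (`|z| / z); rewrite mulrVK ?unitfE// rnormE; split=> //.
by rewrite /rnorm normf_div normr_id divff ?normr_eq0// -of_real1 of_realK.
Qed.

Lemma nbhs_rnorm (V : normedModType K) (x : V) (A : set V) :
  nbhs x A <-> exists e : R, 0 < e /\ forall y, rnorm (x - y) < e -> A y.
Proof.
have ltE (a b : R) : (of_real a < of_real b :> K) = (a < b).
  by rewrite !lt_neqAle le_of_real (can_eq (@of_realK R k)).
rewrite -nbhs_nbhs_norm; split.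
  move=> [e /= e0 H]; exists (real_part e).
  have eE : of_real (real_part e) = e by rewrite real_partK// ltW.
  split; first by rewrite -ltE eE of_real0.
  by move=> y xy; apply: H; rewrite /= -eE -rnormE ltE.
move=> [e [e0 H]]; exists (of_real e); first by rewrite /= -of_real0 ltE.
by move=> y /=; rewrite -rnormE ltE; exact: H.
Qed.

Lemma cvg_rnorm (V : normedModType K) (T : Type) (U : set_system T) (FU : Filter U)
    (h : T -> V) (l : V) :
  h @ U --> l <-> forall e : R, 0 < e -> U [set t | rnorm (l - h t) < e].
Proof.
split=> [hl e e0|H A /nbhs_rnorm[e [e0 eA]]].
  suff /hl : nbhs l [set y | rnorm (l - y) < e] by [].
  by apply/nbhs_rnorm; exists e.
by apply: (@filterS _ U _ _ (h @^-1` A) _ (H e e0)) => t; exact: eA.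
Qed.

Lemma cvg_lincomb (V : normedModType K) (T : Type) (U : set_system T) (FU : Filter U)
    (a : K) (g h : T -> V) (l m : V) :
  g @ U --> l -> h @ U --> m -> (fun t => a *: g t + h t) @ U --> a *: l + m.
Proof. by move=> gl hm; apply: cvgD => //; exact: cvgZl_tmp. Qed.

Lemma closure_rnorm (V : normedModType K) (A : set V) (x : V) :
  closure A x <-> forall e : R, 0 < e -> exists2 y, A y & rnorm (x - y) < e.
Proof.
split=> [H e e0|H B /nbhs_rnorm[e [e0 eB]]].
  have /H [y [Ay xy]] : nbhs x [set y | rnorm (x - y) < e].
    by apply/nbhs_rnorm; exists e.
  by exists y.
by have [y Ay xy] := H _ e0; exists y; split => //; exact: eB xy.
Qed.

Lemma cvg_rnorm_le (V : normedModType K) (T : Type) (U : set_system T)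
    (PU : ProperFilter U) (h : T -> V) (l x : V) (M : R) :
  h @ U --> l -> U [set t | rnorm (x - h t) <= M] -> rnorm (x - l) <= M.
Proof.
move=> /cvg_rnorm hl hM; apply/ler_addgt0Pr => e e0.
have [t [/= t1 t2]] := filter_ex (filterI hM (hl _ e0)).
by rewrite (le_trans (rnorm_triangle _ (h t) _))// rnormBC (rnormBC (h t)) lerD// 1?rnormBC// ltW.
Qed.

Lemma sup_image_adherent (I : Type) (P : set I) (f : I -> R) (i0 : I) (e : R) :
  P i0 -> (forall i, 0 <= f i) -> 0 < e ->
  exists2 i, P i & sup [set f i | i in P] - e < f i.
Proof.
move=> Pi0 f0 e0.
have [hs|hs] := pselect (has_sup [set f i | i in P]); last first.
  by exists i0 => //; rewrite (sup_out hs) sub0r (lt_le_trans _ (f0 i0))// oppr_lt0.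
by have [_ [i Pi <-] ?] := sup_adherent e0 hs; exists i.
Qed.

End real_norm.

(** * Bounded ultrafilters in finite-dimensional spaces *)

Section Heine_Borel.
Context {R : realType} {k : scalar_kind}.
Local Notation K := (scalars R k).

(** A cluster point of the image of an ultrafilter is a limit of it, because every
    neighbourhood or its complement pulls back to a member of the ultrafilter. *)
Lemma ultra_map_cvg (T : Type) (V : topologicalType) (U : set_system T)
    (UU : UltraFilter U) (h : T -> V) (A : set V) :
  compact A -> U (h @^-1` A) -> exists2 l, A l & h @ U --> l.
Proof.
move=> cA UA; have [l [Al cl]] := cA (h @ U) _ UA.
exists l => // B Bl; have [//|nB] := in_ultra_setVsetC (h @^-1` B) UU.
by have [y [nBy By]] := cl (~` B) B nB Bl; case: (nBy By).
Qed.

(** Over the complex numbers, the real and the imaginary part converge separately. *)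
Lemma ultra_scalar_cvg (T : Type) (U : set_system T) (UU : UltraFilter U)
    (h : T -> K) (M : R) :
  U [set t | rnorm (h t : K^o) <= M] -> exists l : K^o, (h : T -> K^o) @ U --> l.
Proof.
have real_case (g : T -> R) : U [set t | `|g t| <= M] ->
    exists l : R, forall e : R, 0 < e -> U [set t | `|l - g t| < e].
  move=> gM; have [|l _ gl] := @ultra_map_cvg T R U UU g `[- M, M] (@segment_compact R _ _).
    by apply: filterS gM => t /=; rewrite in_itv /= ler_norml.
  by exists l; move/cvgrPdist_lt: gl.
move=> hM; case: k h hM => h hM.
  have [l gl] := real_case h hM; exists l; apply/(@cvg_rnorm R RealScalars (R^o)) => e e0.
  exact: (gl e e0).
have hM' : U [set t | Num.sqrt ((complex.Re (h t))^+2 + (complex.Im (h t))^+2) <= M].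
  by apply: filterS hM => t; rewrite /mkset rnorm_complex.
have abs_le (a b : R) : `|a| <= Num.sqrt (a ^+ 2 + b ^+ 2).
  by rewrite -sqrtr_sqr ler_wsqrtr// lerDl sqr_ge0.
have le_abs (x y : R) : Num.sqrt (x ^+ 2 + y ^+ 2) <= `|x| + `|y|.
  rewrite -[leRHS]ger0_norm ?addr_ge0// -sqrtr_sqr ler_wsqrtr// sqrrD.
  by rewrite !real_normK ?num_real// addrAC lerDl mulrn_wge0// mulr_ge0.
have [|a ga] := real_case (fun t => complex.Re (h t)).
  by apply: filterS hM' => t /=; apply: le_trans.
have [|b gb] := real_case (fun t => complex.Im (h t)).
  by apply: filterS hM' => t /=; apply: le_trans; rewrite addrC.
exists (a +i* b)%C; apply/(@cvg_rnorm R ComplexScalars (R[i]^o)) => e e0.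
have e2 : 0 < e / 2 by rewrite divr_gt0.
apply: filterS (filterI (ga _ e2) (gb _ e2)) => t [].
rewrite /mkset rnorm_complex; case: (h t) => c d /= ac bd.
have -> : e = e / 2 + e / 2 by field.
exact: le_lt_trans (le_abs _ _) (ltrD ac bd).
Qed.

Variable V : normedModType K.

Fixpoint list_span (s : seq V) : set V :=
  if s is e :: s' then [set x | exists (c : K) w, list_span s' w /\ x = c *: e + w]
  else [set 0].

(** Compactness of the bounded closed parts of [W], stated for functions because the
    induction on the dimension has to split a vector into two functions of one index. *)
Definition bounded_ultra_cvg (W : set V) :=
  forall (T : Type) (U : set_system T), UltraFilter U ->
  forall (h : T -> V) (M : R), U [set t | W (h t) /\ rnorm (h t) <= M] ->
  exists2 l, W l & h @ U --> l.

Lemma list_spanZ s (a : K) x : list_span s x -> list_span s (a *: x).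
Proof.
elim: s x => [|e s IH] x /=; first by move->; rewrite scaler0.
move=> [c [w [sw ->]]]; exists (a * c), (a *: w); split; first exact: IH.
by rewrite scalerDr scalerA.
Qed.

Lemma list_spanD s x y : list_span s x -> list_span s y -> list_span s (x + y).
Proof.
elim: s x y => [|e s IH] x y /=; first by move=> -> ->; rewrite addr0.
move=> [c [w [sw ->]]] [d [z [sz ->]]]; exists (c + d), (w + z); split; first exact: IH.
by rewrite scalerDl addrACA.
Qed.

Lemma bounded_ultra_cvg_closed W : bounded_ultra_cvg W -> closed W.
Proof.
move=> WU x; rewrite closureEcvg => -[G PG [Gx WG]].
have [U [UU GU]] := ultraFilterLemma PG.
have Ux : U --> x by move=> A /Gx/GU.
have [|l Wl Ul] := WU _ U UU id (rnorm x + 1).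
  apply: filterI; first by apply: GU; exact: WG.
  apply: Ux; apply/nbhs_rnorm; exists 1; split=> // y xy /=.
  have := rnormD x (y - x); rewrite addrC subrK => /le_trans; apply.
  by rewrite lerD2l rnormBC ltW.
by rewrite (cvg_unique (@norm_hausdorff _ V) Ux Ul).
Qed.

(** Heine-Borel, by induction on a spanning list: the span of the tail of the list is
    closed by the induction hypothesis, hence the coefficient on a new vector outside of
    it is controlled by the norm, and both components converge along the ultrafilter. *)
Lemma list_span_ultra_cvg s : bounded_ultra_cvg (list_span s).
Proof.
elim: s => [|e s IH] T U UU h M hM /=.
  exists 0 => //; apply/cvg_rnorm => r r0.
  by apply: filterS hM => t [/= -> _]; rewrite subr0 rnorm0.
have [es|nes] := pselect (list_span s e).
  have [|l sl hl] := IH T U UU h M.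
    apply: filterS hM => t [hs hM]; split=> //; case: hs => c [w [sw ->]].
    by apply: (list_spanD _ sw); exact: list_spanZ.
  by exists l => //; exists 0, l; rewrite scale0r add0r.
(* the distance from e to the closed span of s is positive *)
have [d d0 ed] : exists2 d : R, 0 < d & forall w, list_span s w -> d <= rnorm (e - w).
  apply: contrapT => nd; apply: nes.
  apply: (bounded_ultra_cvg_closed IH).
  apply/closure_rnorm => r r0; apply: contrapT => nr; apply: nd; exists r => // w sw.
  by rewrite leNgt; apply/negP => ?; apply: nr; exists w.
have coef_le c w : list_span s w -> rnorm (c : K^o) * d <= rnorm (c *: e + w).
  move=> sw; have [->|c0] := eqVneq c 0.
    by rewrite (@rnorm0 R k (K^o)) mul0r rnorm_ge0.
  have -> : c *: e + w = c *: (e - (- c^-1) *: w).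
    by rewrite scalerBr scalerA mulrN mulfV// scaleN1r opprK.
  rewrite rnormZ ler_wpM2l ?rnorm_ge0//; apply: ed; exact: list_spanZ.
have [cw cwE] : {cw : T -> K * V & forall t, list_span (e :: s) (h t) ->
    list_span s (cw t).2 /\ h t = (cw t).1 *: e + (cw t).2}.
  apply: (@choice _ _ (fun t (cw : K * V) => list_span (e :: s) (h t) ->
    list_span s cw.2 /\ h t = cw.1 *: e + cw.2)) => t.
  have [[c [w [sw E]]]|nsp] := pselect (list_span (e :: s) (h t)); first by exists (c, w).
  by exists (0, 0) => /nsp.
have Uc : U [set t | rnorm ((cw t).1 : K^o) <= M / d].
  apply: filterS hM => t [/cwE[sw E] hM] /=.
  by rewrite ler_pdivlMr// (le_trans (coef_le _ _ sw))// -E.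
have [c0 cc0] := ultra_scalar_cvg UU Uc.
have [|w0 sw0 ww0] := IH T U UU (fun t => (cw t).2) (M + M / d * rnorm e).
  apply: filterS (filterI Uc hM) => t [/= tc [/cwE[sw E] hM']]; split=> //.
  have -> : (cw t).2 = h t - (cw t).1 *: e by rewrite E addrC addKr.
  by rewrite (le_trans (rnormD _ _))// rnormN rnormZ lerD// ler_wpM2r ?rnorm_ge0.
exists (c0 *: e + w0); first by exists c0, w0.
have /cvg_rnorm H : (fun t => (cw t).1 *: e + (cw t).2) @ U --> c0 *: e + w0.
  by apply: cvgD => //; exact: cvgZl.
apply/cvg_rnorm => r r0.
by apply: filterS (filterI hM (H r r0)) => t [[/cwE[_ E] _]]; rewrite /mkset -E.
Qed.

Lemma finite_dimensional_ultra_cvg : finite_dimensional V -> bounded_ultra_cvg [set: V].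
Proof.
move=> [n [e eV]] T U UU h M hM.
have spanV x : list_span (map e (enum 'I_n)) x.
  have [c ->] := eV x; rewrite -big_enum /=.
  elim: (enum _) => [|i s IH] /=; first by rewrite big_nil.
  by rewrite big_cons; exists (c i), (\sum_(j <- s) c j *: e j).
have [|l _ hl] := @list_span_ultra_cvg (map e (enum 'I_n)) T U UU h M.
  by apply: filterS hM => t [_ ?]; split.
by exists l.
Qed.

End Heine_Borel.

(** * Bounded operators *)

Section operators.
Context {R : realType} {k : scalar_kind}.
Local Notation K := (scalars R k).

(** These restate linearity with the operator as head symbol, so that rewriting keeps
    [head_op n x] and [tail_op n x] folded. *)
Lemma operatorD (V W : normedModType K) (T : bounded_operator V W) x y :
  T (x + y) = T x + T y.
Proof. exact: linearD. Qed.

Lemma operatorB (V W : normedModType K) (T : bounded_operator V W) x y :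
  T (x - y) = T x - T y.
Proof. exact: linearB. Qed.

Lemma operatorZ (V W : normedModType K) (T : bounded_operator V W) a x :
  T (a *: x) = a *: T x.
Proof. exact: linearZ. Qed.

Lemma operator0 (V W : normedModType K) (T : bounded_operator V W) : T 0 = 0.
Proof. exact: linear0. Qed.

Lemma operator_ext (V W : normedModType K) (S T : bounded_operator V W) :
  (forall x, S x = T x) -> S = T.
Proof. by move=> ST; apply/val_inj/funext. Qed.

Lemma operator_le (V W : normedModType K) (T : bounded_operator V W) x :
  rnorm (T x) <= operator_rnorm T * rnorm x.
Proof.
have [->|x0] := eqVneq x 0; first by rewrite linear0 !rnorm0 mulr0.
have nx : 0 < rnorm x.
  rewrite lt_neqAle rnorm_ge0 andbT eq_sym; apply: contra x0 => /eqP/rnorm_eq0 ->.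
  by [].
have : `|(of_real (rnorm x)^-1 : K) *: x| <= 1.
  by rewrite -of_real1 rnorm_norm rnormZr ?invr_ge0 ?rnorm_ge0// mulVf// gt_eqF.
move=> /(operator_rnorm_ub T); rewrite linearZ rnormZr ?invr_ge0 ?rnorm_ge0//.
by rewrite ler_pdivrMl// mulrC.
Qed.

Lemma operator_rnorm_le (V W : normedModType K) (T : bounded_operator V W) (M : R) :
  0 <= M -> (forall x, rnorm x <= 1 -> rnorm (T x) <= M) -> operator_rnorm T <= M.
Proof.
move=> M0 H; apply: sup_image_le => // x /=; rewrite -of_real1 rnorm_norm.
exact: H.
Qed.

(** The factor [b] may vanish, so that one cannot simply divide by it. *)
Lemma operator_rnorm_mul_le (V W : normedModType K) (T : bounded_operator V W) (b c : R) :
  0 <= b -> 0 <= c -> (forall y, rnorm y <= 1 -> rnorm (T y) * b <= c) ->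
  operator_rnorm T * b <= c.
Proof.
move=> b0 c0 H; have [->|bn0] := eqVneq b 0; first by rewrite mulr0.
have b1 : 0 < b by rewrite lt_neqAle eq_sym bn0.
rewrite -ler_pdivlMr//; apply: operator_rnorm_le; first by rewrite divr_ge0.
by move=> y y1; rewrite ler_pdivlMr// H.
Qed.

Lemma operator_normE (V W : normedModType K) (T : bounded_operator V W) :
  rnorm T = operator_rnorm T.
Proof. by rewrite /rnorm -[`|T|]/(of_real _) of_realK. Qed.

Lemma bounded_operatorP (V W : normedModType K) (T : V -> W) :
  is_bounded_operator T -> T \in @bounded_operator_pred R k V W.
Proof. by move=> H; apply/asboolP. Qed.

Lemma comp_is_bounded (U V W : normedModType K) (S : bounded_operator V W)
    (T : bounded_operator U V) : is_bounded_operator (S \o T).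
Proof.
split; first by move=> a x y; rewrite /= !linearP.
exists (operator_rnorm S * operator_rnorm T) => x /=.
by rewrite (le_trans (operator_le _ _))// -mulrA ler_wpM2l ?operator_rnorm_ge0// operator_le.
Qed.

Definition comp_operator (U V W : normedModType K) (S : bounded_operator V W)
    (T : bounded_operator U V) : bounded_operator U W :=
  BoundedOperator (bounded_operatorP (comp_is_bounded S T)).

Lemma operator_continuous (V W : normedModType K) (T : bounded_operator V W) :
  continuous T.
Proof.
move=> x; apply/cvg_rnorm => e e0; apply/nbhs_rnorm.
have d0 : 0 < operator_rnorm T + 1 by rewrite ltr_wpDl// operator_rnorm_ge0.
exists (e / (operator_rnorm T + 1)); split; first by rewrite divr_gt0.
move=> y; rewrite /mkset ltr_pdivlMr// => xy.
rewrite -operatorB (le_lt_trans (operator_le _ _))//.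
rewrite (le_lt_trans _ xy)// mulrC ler_wpM2l ?rnorm_ge0// lerDl.
by [].
Qed.

End operators.

(** * Spaces decomposed into blocks *)

(** What the l_p-sum and the c_0-sum have in common: the norm of a vector depends,
    monotonically and through one fixed function [Phi], on the norms of its first [n]
    blocks and of the remaining ones.  The field [growth] says that [n] disjoint
    successive vectors of norm at most one add up to a vector of norm at most [g n], where
    [g n / n] gets arbitrarily small; it holds for [p > 1] and fails for l_1, on which a
    compact operator need not be small on far-away tails. *)
Record block_decomposition (R : realType) (k : scalar_kind)
    (F : nat -> completeNormedModType (scalars R k)) (X : normedModType (scalars R k))
    (coord : X -> vector_sequence F) (truncation : nat -> vector_sequence F -> X)
    (Phi : R -> R -> R) : Prop := BlockDecomposition {
  coord_linear : linear coord;
  coord_inj : injective coord;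
  coord_truncation : forall n y i,
    coord (truncation n y) i = if (i < n)%N then y i else 0;
  norm_split : forall n x, rnorm x =
    Phi (rnorm (truncation n (coord x))) (rnorm (x - truncation n (coord x)));
  Phi_mono : forall a a' b b', 0 <= a -> a <= a' -> 0 <= b -> b <= b' ->
    Phi a b <= Phi a' b';
  coord_le : forall x i, rnorm (coord x i) <= rnorm x;
  truncation_le : forall n y (d : R), (forall i, (i < n)%N -> rnorm (y i) <= d) ->
    0 <= d -> rnorm (truncation n y) <= n%:R * d;
  truncation_cvg : forall x (e : R), 0 < e ->
    exists n, rnorm (x - truncation n (coord x)) <= e;
  coord_complete : forall y,
    (forall e : R, 0 < e -> exists n, forall m, (n <= m)%N ->
      rnorm (truncation m y - truncation n y) <= e) ->
    exists x, coord x = y;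
  growth : exists2 g : nat -> R,
    g 0%N = 0 /\ (forall n, 0 <= g n /\ Phi (g n) 1 <= g n.+1) &
    forall e : R, 0 < e -> exists n, g n < n%:R * e }.

Section block_decomposition_theory.
Context {R : realType} {k : scalar_kind}.
Local Notation K := (scalars R k).
Context {F : nat -> completeNormedModType K} {X : normedModType K}
  {coord : X -> vector_sequence F} {truncation : nat -> vector_sequence F -> X}
  {Phi : R -> R -> R}.
Hypothesis X_dec : block_decomposition coord truncation Phi.

Definition head_fun n (x : X) : X := truncation n (coord x).

Lemma coordP (a : K) x y i : coord (a *: x + y) i = a *: coord x i + coord y i.
Proof. by rewrite (coord_linear X_dec). Qed.

Lemma coord_ext x y : (forall i, coord x i = coord y i) -> x = y.
Proof. by move=> xy; apply: (coord_inj X_dec); exact: functional_extensionality_dep. Qed.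

Lemma coord_head n x i : coord (head_fun n x) i = if (i < n)%N then coord x i else 0.
Proof. exact: (coord_truncation X_dec). Qed.

Lemma head_linear n : linear (head_fun n).
Proof.
move=> a x y; apply: coord_ext => i; rewrite coordP !coord_head coordP.
by case: ifP => // _; rewrite scaler0 addr0.
Qed.

Lemma headK m n x : head_fun m (head_fun n x) = head_fun (minn m n) x.
Proof.
apply: coord_ext => i; rewrite !coord_head leq_min.
by case: (i < m)%N; case: (i < n)%N.
Qed.

Lemma head_le n x : rnorm (head_fun n x) <= rnorm x.
Proof.
rewrite [leLHS](norm_split X_dec n) [leRHS](norm_split X_dec n) -/(head_fun n _).
rewrite headK minnn subrr rnorm0.
by apply: (Phi_mono X_dec) => //; exact: rnorm_ge0.
Qed.

Lemma head_is_bounded n : is_bounded_operator (head_fun n).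
Proof. by split; [exact: head_linear|exists 1 => x; rewrite mul1r head_le]. Qed.

Definition head_op n : bounded_operator X X :=
  BoundedOperator (bounded_operatorP (head_is_bounded n)).

Lemma tail_is_bounded n : is_bounded_operator (fun x => x - head_op n x).
Proof.
split; first by move=> a x y; rewrite linearP opprD addrACA scalerBr.
exists 2 => x; rewrite (le_trans (rnormD _ _))// rnormN.
by have := head_le n x; rewrite /=; lra.
Qed.

Definition tail_op n : bounded_operator X X :=
  BoundedOperator (bounded_operatorP (tail_is_bounded n)).

Lemma head_head m n x : head_op m (head_op n x) = head_op (minn m n) x.
Proof. exact: headK. Qed.

Lemma tailE n x : tail_op n x = x - head_op n x. Proof. by []. Qed.

Lemma head_tail m n x : (m <= n)%N -> head_op m (tail_op n x) = 0.
Proof. by move=> mn; rewrite tailE operatorB head_head (minn_idPl mn) subrr. Qed.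

Lemma tail_tailr m n x : (m <= n)%N -> tail_op m (tail_op n x) = tail_op n x.
Proof. by move=> mn; rewrite [LHS]tailE head_tail// subr0. Qed.

Lemma tail_tail m n x : (m <= n)%N -> tail_op n (tail_op m x) = tail_op n x.
Proof.
move=> mn; rewrite !tailE operatorB head_head (minn_idPr mn) opprB addrA subrK.
by [].
Qed.

Lemma tail_head m n x : (m <= n)%N -> tail_op n (head_op m x) = 0.
Proof. by move=> mn; rewrite tailE head_head (minn_idPr mn) subrr. Qed.

Lemma norm_head_tail n u v :
  rnorm (head_op n u + tail_op n v) = Phi (rnorm (head_op n u)) (rnorm (tail_op n v)).
Proof.
have E : head_op n (head_op n u + tail_op n v) = head_op n u.
  by rewrite operatorD head_tail// addr0 head_head minnn.
rewrite (norm_split X_dec n) -[truncation n _]/(head_op n (head_op n u + tail_op n v)) E.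
by rewrite [head_op n u + tail_op n v]addrC addrK.
Qed.

(** The first blocks and the remaining ones may come from unrelated vectors [u] and [v];
    this is what allows parts of a state to be recombined in [dual_head_tail_le]. *)
Lemma norm_head_tail_le n u v x : rnorm (head_op n u) <= rnorm (head_op n x) ->
  rnorm (tail_op n v) <= rnorm (tail_op n x) -> rnorm (head_op n u + tail_op n v) <= rnorm x.
Proof.
move=> hu hv; rewrite norm_head_tail [leRHS](norm_split X_dec n).
by apply: (Phi_mono X_dec) => //; exact: rnorm_ge0.
Qed.

Lemma tail_le n x : rnorm (tail_op n x) <= rnorm x.
Proof.
have := @norm_head_tail_le n 0 x x; rewrite operator0 add0r; apply=> //.
by rewrite rnorm0 rnorm_ge0.
Qed.

Lemma tail_le_tail m n x : (m <= n)%N -> rnorm (tail_op n x) <= rnorm (tail_op m x).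
Proof. by move=> mn; rewrite -(tail_tail x mn) tail_le. Qed.

Definition uniform_tail (A : set X) :=
  forall e : R, 0 < e -> exists n, forall x, A x -> rnorm (tail_op n x) <= e.

(** The maps [tail_op n] are contractions tending to 0 pointwise, hence uniformly on
    compact sets: otherwise a cluster point of bad vectors would have large tails. *)
Lemma compact_uniform_tail (A C : set X) : compact C -> A `<=` C -> uniform_tail A.
Proof.
move=> cC AC e e0; apply: contrapT => nU.
have [x xP] : {x : nat -> X & forall n, A (x n) /\ e < rnorm (tail_op n (x n))}.
  apply: (@choice _ _ (fun n x => A x /\ e < rnorm (tail_op n x))) => n.
  apply: contrapT => nx; apply: nU; exists n => x Ax.
  by rewrite leNgt; apply/negP => ex; apply: nx; exists x.
have [c [_ xc]] : C `&` cluster (x @ \oo) !=set0.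
  apply: cC; exists 0%N => // n _; exact: AC (xP n).1.
have e2 : 0 < e / 2 by rewrite divr_gt0.
have [n0 cn0] := truncation_cvg X_dec c e2.
have [_ [[m /= n0m <-] cm]] : (x @` [set m | (n0 <= m)%N]) `&`
    [set y | rnorm (c - y) < e / 2] !=set0.
  apply: xc; last by apply/nbhs_rnorm; exists (e / 2).
  by exists n0 => // m /= n0m; exists m.
have := (xP m).2; rewrite ltNge => /negP; apply.
have -> : tail_op m (x m) = tail_op m (x m - c) + tail_op m c by rewrite operatorB subrK.
have -> : e = e / 2 + e / 2 by field.
rewrite (le_trans (rnormD _ _))// lerD//.
  by rewrite (le_trans (tail_le _ _))// rnormBC ltW.
by rewrite (le_trans (tail_le_tail _ n0m)).
Qed.

Hypothesis F_fin : forall i, finite_dimensional (F i).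

Lemma coordB x y i : coord (x - y) i = coord x i - coord y i.
Proof. by rewrite addrC -scaleN1r coordP scaleN1r addrC. Qed.

(** Each block being finite-dimensional, a bounded ultrafilter converges block by block;
    the limiting sequence need not belong to [X]. *)
Lemma coord_ultra_cvg (T : Type) (U : set_system T) (UU : UltraFilter U)
    (h : T -> X) (M : R) : U [set t | rnorm (h t) <= M] ->
  exists y : vector_sequence F, forall n (e : R), 0 < e ->
    U [set t | rnorm (truncation n y - head_op n (h t)) < e].
Proof.
move=> hM.
have hi i : exists y : F i, (fun t => coord (h t) i) @ U --> y.
  have [|y _ hy] := finite_dimensional_ultra_cvg (F_fin i) UU
    (h := fun t => coord (h t) i) (M := M).
    by apply: filterS hM => t ht; split=> //; exact: le_trans (coord_le X_dec _ _) ht.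
  by exists y.
have [y hy] : exists y : vector_sequence F, forall i, (fun t => coord (h t) i) @ U --> y i.
  by exists (fun i => projT1 (cid (hi i))) => i; case: cid.
exists y => n e e0.
have d0 : 0 < e / n.+1%:R by rewrite divr_gt0.
have : U [set t | forall i, (i < n)%N -> rnorm (y i - coord (h t) i) < e / n.+1%:R].
  elim: {1}n => [|m IH]; first by apply: filterS hM.
  apply: filterS (filterI IH ((cvg_rnorm _ _ _).1 (hy m) _ d0)) => t [H1 H2] i.
  by rewrite ltnS leq_eqVlt => /orP[/eqP ->|/H1].
apply: filterS => t H; rewrite /mkset.
have -> : truncation n y - head_op n (h t) = truncation n (fun i => y i - coord (h t) i).
  apply: coord_ext => i; rewrite coordB coord_head !(coord_truncation X_dec).
  by case: ifP => // _; rewrite subr0.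
apply: (@le_lt_trans _ _ (n%:R * (e / n.+1%:R))).
  by apply: (truncation_le X_dec); [move=> i /H/ltW|exact: ltW].
by rewrite mulrCA gtr_pMr// ltr_pdivrMr// mul1r ltr_nat.
Qed.

(** Uniformly small tails upgrade the blockwise limit of an ultrafilter to a norm limit:
    they make the truncations of the limiting sequence a Cauchy sequence. *)
Lemma uniform_tail_precompact (A : set X) (M : R) :
  (forall x, A x -> rnorm x <= M) -> uniform_tail A -> precompact A.
Proof.
move=> AM At; rewrite precompactE compact_ultra => U UU UA.
have AM' x : closure A x -> rnorm x <= M.
  move=> /closure_rnorm cx; apply/ler_addgt0Pr => e /cx[y Ay xy].
  have := rnormD y (x - y); rewrite addrC subrK => /le_trans; apply.
  by rewrite lerD ?AM// ltW.
have At' e : 0 < e -> exists n, forall x, closure A x -> forall m, (n <= m)%N ->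
    rnorm (tail_op m x) <= e.
  move=> e0; have e2 : 0 < e / 2 by rewrite divr_gt0.
  have [n nA] := At _ e2; exists n => x /closure_rnorm/(_ _ e2)[y Ay xy] m nm.
  have -> : tail_op m x = tail_op m (x - y) + tail_op m y by rewrite operatorB subrK.
  have -> : e = e / 2 + e / 2 by field.
  rewrite (le_trans (rnormD _ _))// lerD//.
    by rewrite (le_trans (tail_le _ _))// ltW.
  by rewrite (le_trans (tail_le_tail _ nm))// nA.
have [y Uy] : exists y : vector_sequence F, forall n (e : R), 0 < e ->
    U [set x | rnorm (truncation n y - head_op n x) < e].
  by apply: (@coord_ultra_cvg _ U UU id M); exact: filterS UA.
have y_tail e : 0 < e -> exists n, forall m, (n <= m)%N ->
    rnorm (truncation m y - truncation n y) <= e.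
  move=> e0; have e3 : 0 < e / 3 by rewrite divr_gt0.
  have [n nA] := At' _ e3; exists n => m nm.
  have [x [[xm xn] Ax]] := filter_ex (filterI (filterI (Uy m _ e3) (Uy n _ e3)) UA).
  have -> : truncation m y - truncation n y = (truncation m y - head_op m x) +
      (head_op m (tail_op n x)) - (truncation n y - head_op n x).
    rewrite tailE operatorB head_head (minn_idPr nm).
    by rewrite opprB !addrA !subrK.
  have -> : e = e / 3 + e / 3 + e / 3 by field.
  rewrite (le_trans (rnormD _ _))// rnormN lerD//; last exact: ltW.
  rewrite (le_trans (rnormD _ _))// lerD//; first exact: ltW.
  by rewrite (le_trans (head_le _ _))// nA.
have [z zy] := coord_complete X_dec y_tail.
have zA : U --> z.
  apply/(@cvg_rnorm R k X X U _ id) => e e0; have e4 : 0 < e / 4 by rewrite divr_gt0.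
  have [n nA] := At' _ e4; have [m zm] := truncation_cvg X_dec z e4.
  apply: filterS (filterI (Uy (maxn n m) _ e4) UA) => x [xy Ax]; rewrite /mkset.
  have -> : z - x = tail_op (maxn n m) z + (truncation (maxn n m) y - head_op (maxn n m) x)
      - tail_op (maxn n m) x.
    rewrite !tailE -zy -[truncation _ _]/(head_op (maxn n m) z).
    by rewrite opprB !addrA !subrK.
  apply: (@le_lt_trans _ _ (e / 4 + e / 4 + e / 4)); last by lra.
  rewrite (le_trans (rnormD _ _))// rnormN lerD//; last by apply: nA => //; exact: leq_maxl.
  rewrite (le_trans (rnormD _ _))// lerD//; last exact: ltW.
  by rewrite (le_trans (tail_le_tail _ (leq_maxr n m))).
exists z; split=> //; apply/closure_rnorm => e e0.
have e2 : 0 < e / 2 by rewrite divr_gt0.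
have /filterI/(_ UA) : U [set x | rnorm (z - x) < e / 2].
  suff /zA : nbhs z [set x | rnorm (z - x) < e / 2] by [].
  by apply/nbhs_rnorm; exists (e / 2).
move=> /filter_ex[x [zx /closure_rnorm/(_ _ e2)[w Aw xw]]]; exists w => //.
rewrite (le_lt_trans (rnorm_triangle _ x _))//.
by rewrite [ltRHS](_ : _ = e / 2 + e / 2) ?ltrD//; field.
Qed.

(** * Compact operators through their tails *)

Definition unit_image (T : X -> X) : set X := T @` [set x : X | `|x| <= 1].

Lemma unit_imageP (T : X -> X) y :
  unit_image T y <-> exists2 x, rnorm x <= 1 & T x = y.
Proof.
split=> -[x x1 Tx]; exists x => //.
  by rewrite -(@rnorm_norm R k) of_real1.
by rewrite /= -of_real1 rnorm_norm.
Qed.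

Lemma precompact_uniform_tail (A : set X) : precompact A -> uniform_tail A.
Proof.
by rewrite precompactE => cA; apply: compact_uniform_tail cA _; exact: subset_closure.
Qed.

Lemma compact_operatorP (T : bounded_operator X X) :
  compact_operator T <->
  forall e : R, 0 < e -> exists n, forall x, rnorm x <= 1 -> rnorm (tail_op n (T x)) <= e.
Proof.
split=> [/precompact_uniform_tail cT e /cT[n nT]|cT].
  by exists n => x x1; apply: nT; apply/(unit_imageP T); exists x.
apply: (@uniform_tail_precompact (unit_image T) (operator_rnorm T)).
  move=> _ /unit_imageP[x x1 <-]; rewrite (le_trans (operator_le _ _))//.
  by rewrite ler_piMr// operator_rnorm_ge0.
by move=> e /cT[n nT]; exists n => _ /unit_imageP[x x1 <-]; exact: nT.
Qed.

Lemma compact_operator_linear (a : K) (S T : bounded_operator X X) :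
  compact_operator S -> compact_operator T -> compact_operator (a *: S + T).
Proof.
move=> /compact_operatorP cS /compact_operatorP cT.
apply/compact_operatorP => e e0.
have a0 : 0 <= rnorm (a : K^o) by exact: rnorm_ge0.
have d0 : 0 < e / (rnorm (a : K^o) + 1) by rewrite divr_gt0// ltr_wpDl.
have [n nS] := cS _ d0.
have dE : 0 < e - rnorm (a : K^o) * (e / (rnorm (a : K^o) + 1)).
  rewrite (_ : e - _ = e / (rnorm (a : K^o) + 1))//.
  by field; rewrite gt_eqF// ltr_wpDl.
have [m mT] := cT _ dE.
exists (maxn n m) => x x1.
rewrite -[(a *: S + T) x]/(a *: S x + T x) operatorD operatorZ.
rewrite (le_trans (rnormD _ _))// rnormZ -lerBrDl.
rewrite (le_trans (tail_le_tail _ (leq_maxr n m)))// (le_trans (mT _ x1))//.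
rewrite lerB// ler_wpM2l// (le_trans (tail_le_tail _ (leq_maxl n m)))//.
exact: nS.
Qed.

Lemma head_comp_compact n (T : bounded_operator X X) :
  compact_operator (comp_operator (head_op n) T).
Proof.
apply/compact_operatorP => e e0; exists n => x _.
by rewrite -[comp_operator _ _ x]/(head_op n (T x)) tail_head// rnorm0 ltW.
Qed.

(** The image of the unit ball under [head_op n] is relatively compact, and [T] maps its
    compact closure to a compact set. *)
Lemma comp_head_compact n (T : bounded_operator X X) :
  compact_operator (comp_operator T (head_op n)).
Proof.
have hc : precompact (unit_image (head_op n)).
  apply: (@uniform_tail_precompact _ 1).
    by move=> _ /unit_imageP[x x1 <-]; exact: le_trans (head_le _ _) x1.
  move=> e e0; exists n => _ /unit_imageP[x x1 <-].
  by rewrite tail_head// rnorm0 ltW.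
have cC : compact (T @` closure (unit_image (head_op n))).
  apply: continuous_compact; last by rewrite -precompactE.
  by apply: continuous_subspaceT; exact: operator_continuous.
have tC := compact_uniform_tail cC (@subset_refl _ _).
apply/compact_operatorP => e /tC[m mT].
exists m => x x1; apply: mT; exists (head_op n x) => //.
by apply: subset_closure; apply/unit_imageP; exists x.
Qed.

Definition head_corner n (T : bounded_operator X X) : bounded_operator X X :=
  comp_operator (head_op n) (comp_operator T (head_op n)).

Definition tail_corner n (T : bounded_operator X X) : bounded_operator X X :=
  comp_operator (tail_op n) (comp_operator T (tail_op n)).

Lemma head_corner_compact n T : compact_operator (head_corner n T).
Proof. exact: head_comp_compact. Qed.

(** With [P := head_op n] and [Q := 1 - P], the difference [T - Q T Q] equals
    [P T - P T P + T P]. *)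
Lemma tail_corner_compact n T : compact_operator (T - tail_corner n T).
Proof.
have -> : T - tail_corner n T =
    1 *: comp_operator (head_op n) T + (- 1 *: head_corner n T + comp_operator T (head_op n)).
  apply: operator_ext => x.
  rewrite -[LHS]/(T x - tail_op n (T (tail_op n x))).
  rewrite -[RHS]/(1 *: head_op n (T x) + (- 1 *: head_op n (T (head_op n x)) + T (head_op n x))).
  rewrite scale1r scaleN1r !tailE !operatorB.
  by rewrite !opprB addrC -!addrA addNr addr0.
apply: compact_operator_linear; first exact: head_comp_compact.
by apply: compact_operator_linear; [exact: head_corner_compact|exact: comp_head_compact].
Qed.

(** Gliding hump.  If [T] stayed large on all tails, compactness would give a cluster
    point [c <> 0] of values of [T] on far-away tails of the unit ball.  Summing [N]
    such vectors with successive disjoint supports gives a vector of norm at most [g N],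
    whose image is close to [N c]: a contradiction when [g N / N] is small. *)
Lemma compact_comp_tail (T : bounded_operator X X) : compact_operator T ->
  forall e : R, 0 < e -> exists n, forall x, rnorm x <= 1 -> rnorm (T (tail_op n x)) <= e.
Proof.
move=> cT e e0; apply: contrapT => nT.
have [x xP] : {x : nat -> X & forall n, rnorm (x n) <= 1 /\ e < rnorm (T (tail_op n (x n)))}.
  apply: (@choice _ _ (fun n x => rnorm x <= 1 /\ e < rnorm (T (tail_op n x)))) => n.
  apply: contrapT => nx; apply: nT; exists n => x x1.
  by rewrite leNgt; apply/negP => ex; apply: nx; exists x.
pose z n := T (tail_op n (x n)).
have [c [_ zc]] : closure (unit_image T) `&` cluster (z @ \oo) !=set0.
  move: cT; rewrite /compact_operator precompactE; apply.
  exists 0%N => // n _; apply: subset_closure; apply/unit_imageP.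
  by exists (tail_op n (x n)) => //; exact: le_trans (tail_le _ _) (xP n).1.
have zcn n (r : R) : 0 < r -> exists2 m, (n <= m)%N & rnorm (c - z m) < r.
  move=> r0; have [_ [[m /= nm <-] cm]] : (z @` [set m | (n <= m)%N]) `&`
      [set y | rnorm (c - y) < r] !=set0.
    apply: zc; last by apply/nbhs_rnorm; exists r.
    by exists n => // m /= nm; exists m.
  by exists m.
have ec : e <= rnorm c.
  apply/ler_addgt0Pr => r /(zcn 0%N)[m _ cm].
  have := rnormD c (z m - c); rewrite addrC subrK => h.
  by rewrite (le_trans (ltW (xP m).2))// (le_trans h)// lerD2l rnormBC ltW.
have e4 : 0 < e / 4 by rewrite divr_gt0.
(* A vector of the n-th tail with finitely many blocks, on which T is still close to c;
   one e/4 pays for the cluster point, the other for truncating. *)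
have block n : exists u l, [/\ rnorm u <= 1, tail_op n u = u, head_op l u = u &
    rnorm (T u - c) <= e / 2].
  have [m nm cm] := zcn n _ e4.
  have d0 : 0 < operator_rnorm T + 1 by rewrite ltr_wpDl// operator_rnorm_ge0.
  have [l ul] := truncation_cvg X_dec (tail_op m (x m)) (divr_gt0 e4 d0).
  exists (head_op l (tail_op m (x m))), l; split.
  - by rewrite (le_trans (head_le _ _))// (le_trans (tail_le _ _))//; exact: (xP m).1.
  - have nlm : (minn n l <= m)%N := leq_trans (geq_minl _ _) nm.
    by rewrite [LHS]tailE head_head (head_tail _ nlm) subr0.
  - by rewrite head_head minnn.
  have -> : e / 2 = e / 4 + e / 4 by field.
  rewrite (le_trans (rnorm_triangle _ (z m) _))// lerD//; last by rewrite rnormBC ltW.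
  rewrite rnormBC -operatorB (le_trans (operator_le _ _))//.
  rewrite (le_trans (ler_wpM2l (operator_rnorm_ge0 T) ul))//.
  rewrite mulrCA ler_piMr ?(ltW e4)// ler_pdivrMr// mul1r lerDl.
  by [].
have [g [g0 gS] gsmall] := growth X_dec.
(* Since [rnorm c >= e], an error of e/2 per block leaves at least [N * (e / 2)]. *)
have hump N : exists y l, [/\ head_op l y = y, rnorm y <= g N &
    rnorm (T y - N%:R *: c) <= N%:R * (e / 2)].
  elim: N => [|N [y [l [ly yg yc]]]].
    by exists 0, 0%N; rewrite !operator0 scale0r subr0 rnorm0 g0 mul0r.
  have [u [m [u1 nu mu uc]]] := block l.
  exists (y + u), (maxn l m); split.
  - rewrite operatorD -{1}ly -{1}mu !head_head.
    by rewrite (minn_idPr (leq_maxl _ _)) (minn_idPr (leq_maxr _ _)) ly mu.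
  - rewrite -ly -nu norm_head_tail ly nu.
    by apply: le_trans (gS N).2; apply: (Phi_mono X_dec); rewrite ?rnorm_ge0.
  have -> : T (y + u) - N.+1%:R *: c = (T y - N%:R *: c) + (T u - c).
    by rewrite operatorD -natr1 scalerDl scale1r opprD addrACA.
  by rewrite (le_trans (rnormD _ _))// -natr1 mulrDl mul1r lerD.
have d0 : 0 < operator_rnorm T + 1 by rewrite ltr_wpDl// operator_rnorm_ge0.
have [N gN] := gsmall _ (divr_gt0 (divr_gt0 e0 (ltr0n R 2)) d0).
have [y [l [_ yg yc]]] := hump N.
have Nc : N%:R * e <= operator_rnorm T * g N + N%:R * (e / 2).
  have nN : rnorm (N%:R *: c) = N%:R * rnorm c.
    by rewrite rnormZ /rnorm normr_nat -(@of_realK R k N%:R); congr (real_part _ * _);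
      elim: (N) => [|j IH]; rewrite ?of_real0// -!natr1 of_realD of_real1 -IH.
  have : N%:R * e <= rnorm (N%:R *: c) by rewrite nN ler_wpM2l.
  move/le_trans; apply.
  have := rnormD (T y) (N%:R *: c - T y); rewrite addrC subrK => /le_trans; apply.
  rewrite lerD//; last by rewrite rnormBC.
  by rewrite (le_trans (operator_le _ _))// ler_wpM2l// operator_rnorm_ge0.
have : operator_rnorm T * g N <= (operator_rnorm T + 1) * g N.
  by rewrite ler_wpM2r ?lerDl//; exact: (gS N).1.
have : (operator_rnorm T + 1) * g N < N%:R * (e / 2).
  rewrite mulrC -ltr_pdivlMr// -mulrA; exact: gN.
have E : N%:R * e = N%:R * (e / 2) + N%:R * (e / 2) by field.
by move: Nc E; lra.
Qed.

(** [T - P T P = T Q + Q T P], where both terms are small when [T] is compact. *)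
Lemma compact_corner_cvg (T : bounded_operator X X) : compact_operator T ->
  forall e : R, 0 < e -> exists n, forall m, (n <= m)%N ->
    operator_rnorm (T - head_corner m T) <= e.
Proof.
move=> cT e e0; have e2 : 0 < e / 2 by rewrite divr_gt0.
have [n1 H1] := compact_comp_tail cT e2.
have [n2 H2] := (compact_operatorP T).1 cT _ e2.
exists (maxn n1 n2) => m; rewrite geq_max => /andP[n1m n2m].
apply: operator_rnorm_le => [|x x1]; first exact: ltW.
rewrite -[(T - head_corner m T) x]/(T x - head_op m (T (head_op m x))).
have -> : T x - head_op m (T (head_op m x)) =
    T (tail_op n1 (tail_op m x)) + tail_op m (T (head_op m x)).
  by rewrite tail_tailr// !tailE operatorB addrA subrK.
have -> : e = e / 2 + e / 2 by field.
rewrite (le_trans (rnormD _ _))// lerD//.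
  by apply: H1; rewrite (le_trans (tail_le _ _)).
by rewrite (le_trans (tail_le_tail _ n2m))// H2// (le_trans (head_le _ _)).
Qed.

End block_decomposition_theory.

(** * The numerical radius *)

Section numerical_radius_facts.
Context {R : realType} {k : scalar_kind}.
Local Notation K := (scalars R k).
Context {X : normedModType K}.
Implicit Types S T : bounded_operator X X.

Lemma numerical_radius_le_norm T : numerical_radius T <= operator_rnorm T.
Proof.
by apply: sup_image_le; [exact: operator_rnorm_ge0|exact: numerical_radius_bounded].
Qed.

(** The constant is the numerical index itself, or any positive number when the index is
    infinite, in which case every operator vanishes. *)
Lemma numerical_radius_equiv : (0 < numerical_index X)%E ->
  exists2 c : R, 0 < c & forall T, c * operator_rnorm T <= numerical_radius T.
Proof.
move=> nX; have [c c0 cn] : exists2 c : R, 0 < c & (c%:E <= numerical_index X)%E.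
  case: (numerical_index X) nX => [r r0|_|//]; first by exists r.
  by exists 1 => //; rewrite leey.
exists c => // T; have [->|T0] := eqVneq (operator_rnorm T) 0.
  by rewrite mulr0 numerical_radius_ge0.
have T1 : 0 < operator_rnorm T by rewrite lt_neqAle eq_sym T0 operator_rnorm_ge0.
have /(le_trans cn) : (numerical_index X <=
    (numerical_radius ((of_real (operator_rnorm T)^-1 : K) *: T))%:E)%E.
  apply: ereal_inf_lbound; exists ((of_real (operator_rnorm T)^-1 : K) *: T) => //=.
  rewrite -of_real1; apply/rnorm_normE; rewrite rnormZr ?invr_ge0 ?(ltW T1)//.
  by rewrite operator_normE mulVf.
rewrite lee_fin numerical_radiusZ rnorm_ge_real ?invr_ge0 ?(ltW T1)//.
by rewrite ler_pdivlMl// mulrC.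
Qed.

(** A pair on which a functional attains the product of the norms is a nonnegative
    multiple of a state, unless it is degenerate, when the left-hand side is 0. *)
Lemma numerical_radius_norming (g : dual X) y S :
  g y = of_real (operator_rnorm g * rnorm y) ->
  rnorm (g (S y)) <= numerical_radius S * (operator_rnorm g * rnorm y).
Proof.
move=> gy; have [g0|g0] := eqVneq (operator_rnorm g) 0.
  by have := operator_le g (S y); rewrite g0 !mul0r mulr0.
have [y0|y0] := eqVneq (rnorm y) 0.
  by rewrite (rnorm_eq0 y0) !operator0 !rnorm0 !mulr0.
have g1 : 0 < operator_rnorm g by rewrite lt_neqAle eq_sym g0 operator_rnorm_ge0.
have y1 : 0 < rnorm y by rewrite lt_neqAle eq_sym y0 rnorm_ge0.
pose g' : dual X := (of_real (operator_rnorm g)^-1 : K) *: (g : bounded_operator X K^o).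
pose y' : X := (of_real (rnorm y)^-1 : K) *: y.
have st : states (g', y').
  split => /=.
  - rewrite -of_real1; apply/rnorm_normE; rewrite rnormZr ?invr_ge0 ?(ltW g1)//.
    by rewrite (@operator_normE R k X K^o g); exact: mulVf.
  - by rewrite -of_real1; apply/rnorm_normE; rewrite rnormZr ?invr_ge0 ?(ltW y1)// mulVf.
  rewrite -[LHS]/((of_real (operator_rnorm g)^-1 : K) * g ((of_real (rnorm y)^-1 : K) *: y)).
  rewrite operatorZ gy -[(_ : K) *: _]/((of_real (rnorm y)^-1 : K) * of_real (operator_rnorm g * rnorm y)).
  by rewrite -!of_realM mulrCA mulKf// mulVf// of_real1.
have /(_ _ st) : forall fx, states fx -> _ := @numerical_radius_ub R k X S.
have -> : (g', y').1 (S (g', y').2) =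
    (of_real (operator_rnorm g)^-1 : K) *: ((of_real (rnorm y)^-1 : K) *: (g (S y) : K^o)).
  by rewrite -[LHS]/((of_real (operator_rnorm g)^-1 : K) *: (g (S y') : K^o))
    operatorZ (operatorZ g).
rewrite !rnormZr ?invr_ge0 ?(ltW g1) ?(ltW y1)//.
rewrite ler_pdivrMl// ler_pdivrMl// => /le_trans; apply.
by rewrite [leRHS]mulrC -mulrA mulrCA.
Qed.

End numerical_radius_facts.

Section splitting.
Context {R : realType} {k : scalar_kind}.
Local Notation K := (scalars R k).
Context {F : nat -> completeNormedModType K} {X : normedModType K}
  {coord : X -> vector_sequence F} {truncation : nat -> vector_sequence F -> X}
  {Phi : R -> R -> R}.
Hypothesis X_dec : block_decomposition coord truncation Phi.
Local Notation head_op := (head_op X_dec).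
Local Notation tail_op := (tail_op X_dec).
Local Notation head_corner := (head_corner X_dec).
Local Notation tail_corner := (tail_corner X_dec).

(** Hoelder's inequality for the pairing of the two parts, obtained from monotonicity of
    the norm alone: if [y] and [z] are unit vectors at which [f o P] and [f o Q]
    nearly attain their norms, then recombining them with the weights [|P x|] and [|Q x|] gives a
    vector of norm at most [|x|]. *)
Lemma dual_head_tail_le n (f : bounded_operator X K^o) x :
  operator_rnorm (comp_operator f (head_op n)) * rnorm (head_op n x) +
  operator_rnorm (comp_operator f (tail_op n)) * rnorm (tail_op n x) <=
  operator_rnorm f * rnorm x.
Proof.
set b := rnorm (head_op n x); set d := rnorm (tail_op n x).
have b0 : 0 <= b by exact: rnorm_ge0.
have d0 : 0 <= d by exact: rnorm_ge0.
have main y z : rnorm y <= 1 -> rnorm z <= 1 ->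
    rnorm (f (head_op n y)) * b + rnorm (f (tail_op n z)) * d <= operator_rnorm f * rnorm x.
  move=> y1 z1.
  have [t [t1 ty]] := exists_phase (f (head_op n y)).
  have [s [s1 sz]] := exists_phase (f (tail_op n z)).
  pose w := head_op n ((of_real b * t) *: y) + tail_op n ((of_real d * s) *: z).
  have fw : f w = of_real (rnorm (f (head_op n y)) * b + rnorm (f (tail_op n z)) * d).
    rewrite /w operatorD (operatorZ (head_op n)) (operatorZ (tail_op n)) !(operatorZ f).
    rewrite -[LHS]/((of_real b * t) * f (head_op n y) + (of_real d * s) * f (tail_op n z) : K).
    by rewrite -!mulrA ty sz -!of_realM -of_realD [b * _]mulrC [d * _]mulrC.
  have wx : rnorm w <= rnorm x.
    apply: norm_head_tail_le; rewrite operatorZ rnormZ rnormM rnorm_ge_real//.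
      by rewrite t1 mulr1 ler_piMr//; exact: le_trans (head_le X_dec _ _) y1.
    by rewrite s1 mulr1 ler_piMr//; exact: le_trans (tail_le X_dec _ _) z1.
  have := operator_le f w; rewrite fw rnorm_ge_real.
    by move=> /le_trans; apply; rewrite ler_wpM2l// operator_rnorm_ge0.
  by rewrite addr_ge0// mulr_ge0// rnorm_ge0.
have r0 : rnorm (0 : X) <= 1 by rewrite rnorm0.
have step y : rnorm y <= 1 -> operator_rnorm (comp_operator f (tail_op n)) * d <=
    operator_rnorm f * rnorm x - rnorm (f (head_op n y)) * b.
  move=> y1; apply: operator_rnorm_mul_le => //.
    by have := main y 0 y1 r0; rewrite !operator0 rnorm0 mul0r addr0 subr_ge0.
  by move=> z z1; rewrite lerBrDl; exact: main.
rewrite -lerBrDr; apply: operator_rnorm_mul_le => //.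
  by have := step 0 r0; rewrite !operator0 rnorm0 mul0r subr0 subr_ge0.
by move=> y y1; rewrite lerBrDr -lerBrDl; exact: step.
Qed.

(** For a state, equality holds throughout in [1 = f (P x) + f (Q x) <= |f P| |P x| +
    |f Q| |Q x| <= 1], so that each of the two parts is a multiple of a state. *)
Lemma state_head_tail n (f : dual X) (x : X) : states (f, x) ->
  let a := operator_rnorm (comp_operator (f : bounded_operator X K^o) (head_op n)) in
  let c := operator_rnorm (comp_operator (f : bounded_operator X K^o) (tail_op n)) in
  [/\ f (head_op n x) = of_real (a * rnorm (head_op n x)),
      f (tail_op n x) = of_real (c * rnorm (tail_op n x)) &
      a * rnorm (head_op n x) + c * rnorm (tail_op n x) = 1].
Proof.
move=> st a c; have [f1 x1 fx1] : [/\ `|f| = 1, `|x| = 1 & f x = 1] := st.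
have nf : operator_rnorm (f : bounded_operator X K^o) = 1.
  by rewrite -operator_normE; apply/rnorm_normE; rewrite of_real1.
have nx : rnorm x = 1 by apply/rnorm_normE; rewrite of_real1.
have := dual_head_tail_le n f x; rewrite nf nx mulr1 -/a -/c => ac.
have ha : rnorm (f (head_op n x) : K^o) <= a * rnorm (head_op n x).
  have := operator_le (comp_operator (f : bounded_operator X K^o) (head_op n)) (head_op n x).
  by rewrite -[comp_operator _ _ _]/(f (head_op n (head_op n x))) head_head minnn.
have hc : rnorm (f (tail_op n x) : K^o) <= c * rnorm (tail_op n x).
  have := operator_le (comp_operator (f : bounded_operator X K^o) (tail_op n)) (tail_op n x).
  by rewrite -[comp_operator _ _ _]/(f (tail_op n (tail_op n x))) tail_tail.
have s1 : real_part (f (head_op n x)) + real_part (f (tail_op n x)) = 1.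
  rewrite -real_partDE -(operatorD (f : bounded_operator X K^o)) tailE addrCA subrr addr0.
  by rewrite fx1 -of_real1 of_realK.
have p1 := real_part_le_rnorm (f (head_op n x)).
have p2 := real_part_le_rnorm (f (tail_op n x)).
split; last by lra.
  by rewrite (of_real_rnorm (z := f (head_op n x))); [congr of_real; lra|lra].
by rewrite (of_real_rnorm (z := f (tail_op n x))); [congr of_real; lra|lra].
Qed.

(** By [state_head_tail] a state splits into multiples of states with weights [a] and [b]
    such that [a + b = 1], one seen by the first operator and the other by the second. *)
Lemma numerical_radius_corners n (S T : bounded_operator X X) (M : R) : 0 <= M ->
  numerical_radius S <= M -> numerical_radius T <= M ->
  numerical_radius (head_corner n S + tail_corner n T) <= M.
Proof.
move=> M0 SM TM; apply: sup_image_le => // -[f x] st.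
have [fh ft s1] := state_head_tail n st; 
rewrite -[X in rnorm X]/(f (head_op n (S (head_op n x)) + tail_op n (T (tail_op n x)))).
rewrite (operatorD (f : bounded_operator X K^o)) (le_trans (rnormD _ _))//.
have hS := @numerical_radius_norming R k X
  (comp_operator (f : bounded_operator X K^o) (head_op n)) (head_op n x) S.
have hT := @numerical_radius_norming R k X
  (comp_operator (f : bounded_operator X K^o) (tail_op n)) (tail_op n x) T.
have {}hS := hS _; have {}hT := hT _.
rewrite -[M]mulr1 -s1 mulrDr lerD//.
  apply: le_trans (hS _) _; first by rewrite -fh -[LHS]/(f (head_op n (head_op n x))) head_head minnn.
  by rewrite ler_wpM2r// mulr_ge0 ?rnorm_ge0 ?operator_rnorm_ge0.
apply: le_trans (hT _) _; first by rewrite -ft -[LHS]/(f (tail_op n (tail_op n x))) tail_tail.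
by rewrite ler_wpM2r// mulr_ge0 ?rnorm_ge0 ?operator_rnorm_ge0.
Qed.

End splitting.

(** * The L-projection *)

Section M_ideal_of_decomposition.
Context {R : realType} {k : scalar_kind}.
Local Notation K := (scalars R k).
Context {F : nat -> completeNormedModType K} {X : normedModType K}
  {coord : X -> vector_sequence F} {truncation : nat -> vector_sequence F -> X}
  {Phi : R -> R -> R}.
Hypothesis X_dec : block_decomposition coord truncation Phi.
Hypothesis F_fin : forall i, finite_dimensional (F i).
Hypothesis nX : (0 < numerical_index X)%E.
Local Notation head_op := (head_op X_dec).
Local Notation tail_op := (tail_op X_dec).
Local Notation Z := (Lv nX).

Lemma Lv_rnormE (T : Z) : rnorm T = numerical_radius T.
Proof. by rewrite /rnorm -[`|T|]/(of_real _) of_realK. Qed.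

(** Compactness is a condition on uniform tails, stable under limits in the operator
    norm; the numerical radius dominates a multiple of this norm. *)
Lemma Kv_closed_subspace : closed_subspace (Kv nX).
Proof.
split.
- apply/(compact_operatorP X_dec F_fin) => e e0; exists 0%N => x _.
  by rewrite -[(0 : Z) x]/(0 : X) operator0 rnorm0 ltW.
- by move=> a S T cS cT; exact: (compact_operator_linear X_dec F_fin a cS cT).
move=> T /closure_rnorm cT; apply/(compact_operatorP X_dec F_fin) => e e0.
have [c c0 cv] := numerical_radius_equiv nX.
have e2 : 0 < e / 2 by rewrite divr_gt0.
have [S cS ST] := cT _ (mulr_gt0 c0 e2).
have [n nS] := (compact_operatorP X_dec F_fin S).1 cS _ e2.
exists n => x x1.
have -> : tail_op n (T x) = tail_op n ((T - S : bounded_operator X X) x) + tail_op n (S x).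
  by rewrite -operatorD -[(T - S) x]/(T x - S x) subrK.
have -> : e = e / 2 + e / 2 by field.
rewrite (le_trans (rnormD _ _))// lerD ?nS//.
rewrite (le_trans (tail_le _ _ _))// (le_trans (operator_le _ _))//.
rewrite (le_trans (ler_piMr (operator_rnorm_ge0 _) x1))//.
rewrite -(ler_pM2l c0) (le_trans (cv _))//.
by move: ST; rewrite Lv_rnormE => /ltW.
Qed.

Let head_corner n (T : Z) : Z := head_corner X_dec n T.
Let tail_corner n (T : Z) : Z := tail_corner X_dec n T.

Lemma Lv_corners n (S T : Z) :
  rnorm S <= 1 -> rnorm T <= 1 -> rnorm (head_corner n S + tail_corner n T) <= 1.
Proof. by rewrite !Lv_rnormE; exact: numerical_radius_corners. Qed.

Lemma head_corner_linear n : linear (head_corner n).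
Proof.
move=> a S T; apply: operator_ext => x.
rewrite -[RHS]/(a *: head_op n (S (head_op n x)) + head_op n (T (head_op n x))).
rewrite -[LHS]/(head_op n (a *: S (head_op n x) + T (head_op n x))).
by rewrite operatorD operatorZ.
Qed.

Lemma tail_cornerZ n (a : K) T : tail_corner n (a *: T) = a *: tail_corner n T.
Proof.
apply: operator_ext => x.
rewrite -[RHS]/(a *: tail_op n (T (tail_op n x))).
by rewrite -[LHS]/(tail_op n (a *: T (tail_op n x))) operatorZ.
Qed.

Lemma head_cornerZ n (a : K) T : head_corner n (a *: T) = a *: head_corner n T.
Proof.
apply: operator_ext => x.
rewrite -[RHS]/(a *: head_op n (T (head_op n x))).
by rewrite -[LHS]/(head_op n (a *: T (head_op n x))) operatorZ.
Qed.

Lemma head_corner_le n T : rnorm (head_corner n T) <= rnorm T.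
Proof.
rewrite !Lv_rnormE.
have := @numerical_radius_corners _ _ _ _ _ _ _ X_dec n T 0 _ (numerical_radius_ge0 T) (lexx _).
rewrite (_ : head_corner n T = head_corner n T + tail_corner n 0); last first.
  have := tail_cornerZ n 0 0; rewrite !scale0r => ->; by rewrite addr0.
apply; apply: le_trans (numerical_radius_ge0 T).
by have := numerical_radiusZ 0 (0 : bounded_operator X X); rewrite scale0r (@rnorm0 R k K^o) mul0r => ->.
Qed.

Variables (U : set_system nat) (UU : UltraFilter U) (Uoo : \oo `<=` U).

(** A limit along an ultrafilter exists for every bounded sequence and depends linearly on
    it, so the projection is linear without any choice of norm-preserving extensions. *)
Definition compact_part_fun (f : dual Z) (T : Z) : K^o :=
  lim ((fun n => f (head_corner n T)) @ U).

Lemma compact_part_cvg (f : dual Z) T :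
  (fun n => f (head_corner n T)) @ U --> compact_part_fun f T.
Proof.
have [|l hl] := @ultra_scalar_cvg R k nat U UU (fun n => f (head_corner n T))
    (operator_rnorm (f : bounded_operator Z K^o) * rnorm T).
  apply: filterS filterT => n _; apply: (le_trans (operator_le (f : bounded_operator Z K^o) _)).
  by rewrite ler_wpM2l ?operator_rnorm_ge0// head_corner_le.
by rewrite /compact_part_fun (cvg_lim _ hl)//; exact: norm_hausdorff.
Qed.

Lemma compact_part_unique (f : dual Z) T (l : K^o) :
  (fun n => f (head_corner n T)) @ U --> l -> compact_part_fun f T = l.
Proof. by move=> hl; apply: cvg_lim hl; exact: norm_hausdorff. Qed.

Lemma compact_part_le (f : dual Z) T :
  rnorm (compact_part_fun f T) <= operator_rnorm (f : bounded_operator Z K^o) * rnorm T.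
Proof.
rewrite -rnormN -[- _]sub0r; apply: (cvg_rnorm_le _ (@compact_part_cvg f T)).
apply: filterS filterT => n _; rewrite /mkset sub0r rnormN.
apply: (le_trans (operator_le (f : bounded_operator Z K^o) _)).
by rewrite ler_wpM2l ?operator_rnorm_ge0// head_corner_le.
Qed.

Lemma compact_part_is_bounded (f : dual Z) :
  is_bounded_operator (compact_part_fun f : Z -> K^o).
Proof.
split; last first.
  by exists (operator_rnorm (f : bounded_operator Z K^o)) => T; exact: compact_part_le.
move=> a S T; apply: compact_part_unique.
rewrite (_ : (fun n => _) = (fun n => a *: f (head_corner n S) + f (head_corner n T))).
  exact: cvg_lincomb (@compact_part_cvg f S) (@compact_part_cvg f T).
apply/funext => n; rewrite head_corner_linear (operatorD (f : bounded_operator Z K^o)).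
by rewrite (operatorZ (f : bounded_operator Z K^o)).
Qed.

Definition compact_part (f : dual Z) : dual Z :=
  BoundedOperator (bounded_operatorP (compact_part_is_bounded f)).

Lemma compact_part_compact (f : dual Z) T : Kv nX T -> compact_part f T = f T.
Proof.
move=> cT; apply: compact_part_unique; apply/cvg_rnorm => e e0; apply: Uoo.
have d0 : 0 < operator_rnorm (f : bounded_operator Z K^o) + 1.
  by rewrite ltr_wpDl// operator_rnorm_ge0.
have e2 : 0 < e / 2 by rewrite divr_gt0.
have [n nT] := compact_corner_cvg X_dec F_fin cT (divr_gt0 e2 d0).
exists n => // m /= nm.
rewrite -(operatorB (f : bounded_operator Z K^o)).
rewrite (le_lt_trans (operator_le _ _))// Lv_rnormE.
have := le_trans (numerical_radius_le_norm _) (nT _ nm).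
rewrite ler_pdivlMr// mulrDr mulr1 mulrC => h.
have v0 := numerical_radius_ge0 (T - head_corner m T : bounded_operator X X).
by apply: (@le_lt_trans _ _ (e / 2)); [apply: le_trans h; rewrite lerDl|lra].
Qed.

Lemma compact_part_linear : linear compact_part.
Proof.
move=> a f g; apply/val_inj/funext => T /=.
apply: compact_part_unique.
exact: cvg_lincomb (@compact_part_cvg f T) (@compact_part_cvg g T).
Qed.

Lemma compact_partK f : compact_part (compact_part f) = compact_part f.
Proof.
apply/val_inj/funext => T /=; apply: compact_part_unique.
rewrite (_ : (fun n => _) = (fun n => f (head_corner n T))).
  exact: compact_part_cvg.
by apply/funext => n; rewrite compact_part_compact//; exact: head_corner_compact.
Qed.

(** The operators [P_n T P_n] being compact, a functional that kills compact operators has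
    no compact part; conversely [compact_part f] and [f] agree on compact operators. *)
Lemma compact_part_kernel : [set f | compact_part f = 0] = annihilator (Kv nX).
Proof.
apply/seteqP; split=> f /= f0.
  by move=> T /(compact_part_compact f) <-; rewrite f0.
apply/val_inj/funext => T /=; apply: compact_part_unique.
rewrite (_ : (fun n => _) = cst 0); first exact: cvg_cst.
by apply/funext => n; apply: f0; exact: head_corner_compact.
Qed.

(** Let [h := compact_part f] and [g := f - h].  Choose a contraction [S = P S P] at which
    [f] and [h] agree and nearly attain the norm of [h], and a contraction [T] at which
    [g] nearly attains its norm.  As [g] vanishes on compact operators, [T] may be replaced
    by [Q T Q] in [g T].  For every phase [u] the operator [S + u Q T Q] is a contraction,
    hence [|h S| + |h (Q T Q)| <= |h|] and [h (Q T Q)] is negligible; therefore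
    [f (S + Q T Q)] nearly equals [|h| + |g|]. *)
Lemma compact_part_Lnorm (f : dual Z) :
  operator_rnorm (compact_part f : bounded_operator Z K^o) +
  operator_rnorm (f - compact_part f : bounded_operator Z K^o) <=
  operator_rnorm (f : bounded_operator Z K^o).
Proof.
pose N (h : dual Z) := operator_rnorm (h : bounded_operator Z K^o).
pose h := compact_part f; pose g : dual Z := f - h.
rewrite -/(N f) -/(N h) -/(N g).
have N_ub (u : dual Z) T : rnorm T <= 1 -> rnorm (u T) <= N u.
  by move=> T1; apply: operator_rnorm_ub; rewrite -(@rnorm_norm R k) of_real1 in T1 *.
have N_adh (u : dual Z) (e : R) : 0 < e -> exists T : Z, [/\ rnorm T <= 1 &
    N u - e < rnorm (u T)].
  move=> e0; have [||T T1 eT] := @sup_image_adherent R Z [set T : Z | `|T| <= 1]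
      (fun T => rnorm (u T)) 0 e _ _ e0.
    by rewrite /mkset normr0.
    by move=> T; exact: rnorm_ge0.
  by exists T; split=> //; rewrite -(@rnorm_norm R k) of_real1.
apply/ler_addgt0Pr => e0 e00; pose e := e0 / 5.
have e_gt0 : 0 < e by rewrite divr_gt0.
have gE T : g T = f T - h T by [].
have [S0 [S01 hS0]] := N_adh h e e_gt0.
have [n hn] : exists n, rnorm (h S0 - f (head_corner n S0)) < e.
  by have /cvg_rnorm/(_ _ e_gt0)/filter_ex := @compact_part_cvg f S0.
have [T0 [T01 gT0]] := N_adh g e e_gt0.
have [t [t1 tS]] := exists_phase (f (head_corner n S0)).
have [s [s1 sT]] := exists_phase (g T0).
pose S := t *: S0; pose T := s *: T0.
pose w := h (tail_corner n T).
have [u [u1 uw]] := exists_phase w.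
have S1 : rnorm S <= 1 by rewrite rnormZ t1 mul1r.
have T1 : rnorm T <= 1 by rewrite rnormZ s1 mul1r.
have uT1 : rnorm (u *: T) <= 1 by rewrite rnormZ u1 mul1r.
have fS : f (head_corner n S) = of_real (rnorm (f (head_corner n S0) : K^o)).
  by rewrite head_cornerZ (operatorZ (f : bounded_operator Z K^o)) -tS.
have hS : h (head_corner n S) = f (head_corner n S).
  by apply: compact_part_compact; exact: head_corner_compact.
have gT : g T = of_real (rnorm (g T0 : K^o)).
  by rewrite /T (operatorZ (g : bounded_operator Z K^o)) -sT.
have gaT : g (tail_corner n T) = g T.
  apply/eqP; rewrite eq_sym -subr_eq0 -(operatorB (g : bounded_operator Z K^o)) gE.
  by rewrite /h compact_part_compact ?subrr//; exact: tail_corner_compact.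
have faT : f (tail_corner n T) = g T + w by rewrite -gaT gE subrK.
(* evaluation of [h] at the contraction [S + u Q T Q] *)
have w_le : rnorm (f (head_corner n S0) : K^o) + rnorm (w : K^o) <= N h.
  have := N_ub h _ (Lv_corners n S1 uT1).
  rewrite (operatorD (h : bounded_operator Z K^o)) hS fS tail_cornerZ.
  rewrite (operatorZ (h : bounded_operator Z K^o)) -[u *: _]/(u * w) uw -of_realD.
  by rewrite rnorm_ge_real// addr_ge0// rnorm_ge0.
(* evaluation of [f] at the contraction [S + Q T Q] *)
have f_ge : rnorm (f (head_corner n S0) : K^o) + rnorm (g T0 : K^o) - rnorm (w : K^o) <= N f.
  have := N_ub f _ (Lv_corners n S1 T1).
  rewrite (operatorD (f : bounded_operator Z K^o)) faT fS gT addrA -of_realD.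
  set r := _ + rnorm (g T0).
  have r0 : 0 <= r by rewrite addr_ge0// rnorm_ge0.
  apply: le_trans; rewrite lerBlDr -{1}(@rnorm_ge_real R k _ r0).
  have := @rnormD R k K^o (of_real r + w) (- w); rewrite addrK rnormN.
  by [].
have : rnorm (h S0 : K^o) <= rnorm (f (head_corner n S0) : K^o) + e.
  have := @rnormD R k K^o (f (head_corner n S0)) (h S0 - f (head_corner n S0)).
  by rewrite addrC subrK => /le_trans; apply; rewrite lerD2l ltW.
have -> : e0 = 5 * e by rewrite /e; field.
by move: hS0 gT0 w_le f_ge; lra.
Qed.

End M_ideal_of_decomposition.

Theorem decomposition_M_ideal (R : realType) (k : scalar_kind)
    (F : nat -> completeNormedModType (scalars R k)) (X : normedModType (scalars R k))
    (coord : X -> vector_sequence F) (truncation : nat -> vector_sequence F -> X)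
    (Phi : R -> R -> R) :
  block_decomposition coord truncation Phi -> (forall i, finite_dimensional (F i)) ->
  forall nX : (0 < numerical_index X)%E, M_ideal (Kv nX).
Proof.
move=> X_dec F_fin nX; split; first exact: (Kv_closed_subspace X_dec F_fin).
have [U [UU Uoo]] := ultraFilterLemma (eventually_filter : ProperFilter \oo).
pose P : dual (Lv nX) -> dual (Lv nX) := compact_part X_dec UU.
have linP : linear P := compact_part_linear X_dec UU.
pose P' : {linear dual (Lv nX) -> dual (Lv nX)} :=
  HB.pack P (GRing.isLinear.Build _ _ _ _ P linP).
exists P'; split.
- exact: (compact_partK X_dec F_fin UU Uoo).
- exact: (compact_part_kernel X_dec F_fin nX UU Uoo).
move=> f; rewrite -!rnormE -of_realD; congr of_real; apply/eqP; rewrite eq_le.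
apply/andP; split.
  by have := rnormD (P f) (f - P f); rewrite addrC subrK.
rewrite !(@operator_normE R k (Lv nX) (scalars R k)^o).
exact: (@compact_part_Lnorm _ _ _ _ _ _ _ X_dec F_fin nX U UU Uoo f).
Qed.

(** * The two sums *)

Section truncated_sequences.
Context {R : realType} {k : scalar_kind}.
Local Notation K := (scalars R k).
Variable F : nat -> completeNormedModType K.

Definition truncated n (y : vector_sequence F) : vector_sequence F :=
  fun i => if (i < n)%N then y i else 0.

Definition partial_powers (p : R) (y : vector_sequence F) n : R :=
  \sum_(0 <= i < n) rnorm (y i) `^ p.

Lemma exists_nat_gt (x : R) : exists n : nat, x < n%:R.
Proof.
exists (Num.truncn x).+1; have [x0|x0] := leP 0 x; first by rewrite truncnS_gt.
by rewrite (lt_le_trans x0).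
Qed.

End truncated_sequences.

Section lp_decomposition.
Context {R : realType} {k : scalar_kind}.
Local Notation K := (scalars R k).
Variables (p : R) (p1 : 1 < p) (F : nat -> completeNormedModType K).
Local Notation X := (lp_sum p1 F).

Let p0 : 0 < p. Proof. exact: lt_trans p1. Qed.

Lemma lp_normE (x : X) : rnorm x = lp_rnorm x.
Proof. by rewrite /rnorm -[`|x|]/(of_real _) of_realK. Qed.

Lemma powR_le_inv (a b : R) : 0 <= a -> 0 <= b -> a `^ p <= b `^ p -> a <= b.
Proof.
by move=> a0 b0; rewrite !leNgt; apply: contra => ba; rewrite gt0_ltr_powR.
Qed.

Lemma powRK (a : R) : 0 <= a -> (a `^ p) `^ p^-1 = a.
Proof. by move=> a0; rewrite -powRrM mulfV ?gt_eqF// powRr1. Qed.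

Lemma powRVK (a : R) : 0 <= a -> (a `^ p^-1) `^ p = a.
Proof. by move=> a0; rewrite -powRrM mulVf ?gt_eqF// powRr1. Qed.

Lemma partial_powers_le_series (y : vector_sequence F) n :
  ((partial_powers p y n)%:E <= lp_series p y)%E.
Proof.
rewrite /partial_powers -sumEFin; apply: nneseries_lim_ge => i _ _.
by rewrite lee_fin powR_ge0.
Qed.

Lemma series_le_partial_powers (y : vector_sequence F) (M : R) n0 :
  (forall n, (n0 <= n)%N -> partial_powers p y n <= M) -> (lp_series p y <= M%:E)%E.
Proof.
move=> H; apply: lime_le; first by apply: is_cvg_nneseries => i _ _; rewrite lee_fin powR_ge0.
by exists n0 => // n /= n0n; rewrite sumEFin lee_fin; exact: H.
Qed.

Lemma lp_series_truncated n (y : vector_sequence F) :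
  lp_series p (truncated n y) = (partial_powers p y n)%:E.
Proof.
rewrite /lp_series (nneseries_split 0%N n); last by move=> i _; rewrite lee_fin powR_ge0.
rewrite add0n eseries0 ?adde0; last first.
  by move=> i ni _; rewrite /truncated ltnNge ni /= rnorm0 powR0// gt_eqF.
rewrite /partial_powers -sumEFin; apply: eq_big_nat => i /andP[_ ni].
by rewrite /truncated ni.
Qed.

Lemma lp_truncation_proof n (y : vector_sequence F) :
  truncated n y \in lp_pred p1 (F := F).
Proof. by apply/asboolP; rewrite lp_series_truncated ltry. Qed.

Definition lp_truncation n (y : vector_sequence F) : X := LpSum (lp_truncation_proof n y).

Lemma lp_truncation_pow n (y : vector_sequence F) :
  rnorm (lp_truncation n y) `^ p = partial_powers p y n.
Proof.
have := lp_rnormE (lp_truncation n y).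
by rewrite lp_series_truncated lp_normE => -[<-].
Qed.

Lemma partial_powers_le_norm (x : X) n : partial_powers p x n <= rnorm x `^ p.
Proof. by rewrite lp_normE -lee_fin -lp_rnormE; exact: partial_powers_le_series. Qed.

Lemma lp_split n (x : X) : rnorm x `^ p =
  rnorm (lp_truncation n x) `^ p + rnorm (x - lp_truncation n x) `^ p.
Proof.
(* For arbitrary extended reals: rewriting with [lp_rnormE] in place would compare the
   norms of different vectors by conversion. *)
have fin_add (A B C : \bar R) (a b c : R) :
    A = a%:E -> B = b%:E -> C = c%:E -> A = (B + C)%E -> a = b + c.
  by move=> -> -> -> [].
rewrite !lp_normE; apply: (fin_add _ _ _ _ _ _ (lp_rnormE _) (lp_rnormE _) (lp_rnormE _)).
rewrite /lp_series -nneseriesD; last 2 first.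
- by move=> i _ _; rewrite lee_fin powR_ge0.
- by move=> i _ _; rewrite lee_fin powR_ge0.
apply: eq_eseriesr => i _; rewrite -EFinD; congr (_%:E).
rewrite -[lp_val (x - _) i]/(lp_val x i - truncated n x i).
rewrite -[lp_val (lp_truncation n x) i]/(truncated n x i) /truncated.
by case: ifP => _; rewrite ?subrr ?subr0 rnorm0 powR0 ?addr0 ?add0r// gt_eqF.
Qed.

Lemma lp_decomposition : block_decomposition (@lp_val R k p p1 F) lp_truncation
  (fun a b => (a `^ p + b `^ p) `^ p^-1).
Proof.
split.
- by move=> a x y.
- exact: val_inj.
- by [].
- by move=> n x; rewrite -lp_split powRK// rnorm_ge0.
- move=> a a' b b' a0 aa b0 bb.
  have a'0 := le_trans a0 aa; have b'0 := le_trans b0 bb.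
  have pV : 0 <= p^-1 by rewrite invr_ge0 ltW.
  apply: (ge0_ler_powR pV); rewrite ?nnegrE ?addr_ge0 ?powR_ge0//.
  by apply: lerD; apply: (ge0_ler_powR (ltW p0)); rewrite ?nnegrE.
- move=> x i; apply: powR_le_inv; rewrite ?rnorm_ge0//.
  apply: le_trans (partial_powers_le_norm x i.+1).
  by rewrite /partial_powers big_nat_recr//= lerDr sumr_ge0// => j _; exact: powR_ge0.
- move=> n y d yd d0; apply: powR_le_inv; rewrite ?rnorm_ge0 ?mulr_ge0//.
  rewrite lp_truncation_pow powRM//.
  apply: (@le_trans _ _ (n%:R * d `^ p)).
    rewrite -[n in leRHS]subn0 mulr_natl -sumr_const_nat /partial_powers.
    apply: ler_sum_nat => i /andP[_ /yd ni].
    by apply: (ge0_ler_powR (ltW p0)); rewrite ?nnegrE ?rnorm_ge0.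
  rewrite ler_wpM2r ?powR_ge0//; case: n yd => [|n _]; first by rewrite powR_ge0.
  by rewrite -[leLHS]powRr1// ler_powR ?ler1n// ltW.
- move=> x e e0; apply: contrapT => nx.
  have ep : 0 < e `^ p by rewrite powR_gt0.
  have : (lp_series p x <= (rnorm x `^ p - e `^ p)%:E)%E.
    apply: (@series_le_partial_powers _ _ 0%N) => n _.
    have eQ : e `^ p <= rnorm (x - lp_truncation n x) `^ p.
      apply: (ge0_ler_powR (ltW p0)); rewrite ?nnegrE ?rnorm_ge0 ?(ltW e0)//.
      by rewrite leNgt; apply/negP => h; apply: nx; exists n; exact: ltW.
    (* Stated for arbitrary reals for the same reason as in [lp_split]. *)
    have le_of_split (a b c d r : R) : a = b + c -> b = d -> r <= c -> d <= a - r.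
      by move=> -> -> rc; rewrite -addrA lerDl subr_ge0.
    exact: le_of_split (lp_split n x) (lp_truncation_pow n x) eQ.
  by rewrite lp_rnormE -lp_normE lee_fin lerBrDr gerDl leNgt ep.
- move=> y /(_ 1 ltr01)[n yn].
  have fin : (lp_series p y < +oo)%E.
    apply: (@le_lt_trans _ _ (((1 + rnorm (lp_truncation n y)) `^ p)%:E)); last by rewrite ltry.
    apply: (@series_le_partial_powers _ _ n) => m nm; rewrite -lp_truncation_pow.
    apply: (ge0_ler_powR (ltW p0)); rewrite ?nnegrE ?addr_ge0 ?rnorm_ge0//.
    have := rnormD (lp_truncation m y - lp_truncation n y) (lp_truncation n y).
    by rewrite subrK => /le_trans; apply; rewrite lerD2r yn.
  by exists (LpSum (asboolT fin)).
(* n unit blocks have norm [n `^ p^-1], and [n = n `^ p^-1 * n `^ q] with [q > 0] *)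
- exists (fun n : nat => n%:R `^ p^-1).
    split; first by rewrite powR0// invr_eq0 gt_eqF.
    by move=> n; rewrite powR_ge0 powRVK// powR1 natr1.
  move=> e e0; pose q := 1 - p^-1.
  have q0 : 0 < q by rewrite subr_gt0 invf_lt1.
  have [n Bn] := exists_nat_gt (e^-1 `^ q^-1).
  have n0 : 0 < n%:R :> R by rewrite (le_lt_trans _ Bn)// powR_ge0.
  have nq : e^-1 < n%:R `^ q.
    have := gt0_ltr_powR q0 _ _ Bn; rewrite -powRrM mulVf ?gt_eqF// powRr1 ?invr_ge0 ?(ltW e0)//.
    by apply; rewrite nnegrE ?powR_ge0 ?ler0n.
  exists n.
  have -> : n%:R * e = n%:R `^ p^-1 * (n%:R `^ q * e).
    rewrite mulrA -powRD; last by rewrite (gt_eqF n0) implybT.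
    by rewrite /q addrCA subrr addr0 powRr1// ltW.
  by rewrite ltr_pMr ?powR_gt0// -ltr_pdivrMr// div1r.
Qed.

End lp_decomposition.

Section c0_decomposition.
Context {R : realType} {k : scalar_kind}.
Local Notation K := (scalars R k).
Variable F : nat -> completeNormedModType K.
Local Notation X := (c0_sum F).

Lemma c0_normE (x : X) : rnorm x = c0_rnorm x.
Proof. by rewrite /rnorm -[`|x|]/(of_real _) of_realK. Qed.

Lemma c0_coord_le (x : X) i : rnorm (c0_val x i) <= rnorm x.
Proof. by rewrite c0_normE; exact: c0_rnorm_ub. Qed.

Lemma c0_norm_le (x : X) (M : R) : 0 <= M ->
  (forall i, rnorm (c0_val x i) <= M) -> rnorm x <= M.
Proof. by move=> M0 xM; rewrite c0_normE; apply: sup_image_le. Qed.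

Lemma c0_predP (y : vector_sequence F) :
  (forall e : R, 0 < e -> exists n, forall i, (n <= i)%N -> rnorm (y i) <= e) <->
  y \in @c0_pred R k F.
Proof.
split=> [H|/asboolP/cvgrPdist_le H e /H[n _ nH]].
  apply/asboolP/cvgrPdist_le => e /H[n nH]; exists n => // i /= ni.
  by rewrite sub0r normrN ger0_norm ?rnorm_ge0// nH.
by exists n => i /nH /=; rewrite sub0r normrN ger0_norm// rnorm_ge0.
Qed.

Lemma c0_truncation_proof n (y : vector_sequence F) : truncated n y \in @c0_pred R k F.
Proof.
apply/c0_predP => e e0; exists n => i ni.
by rewrite /truncated ltnNge ni rnorm0 ltW.
Qed.

Definition c0_truncation n (y : vector_sequence F) : X := C0Sum (c0_truncation_proof n y).

Lemma c0_decomposition : block_decomposition (@c0_val R k F) c0_truncation Num.max.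
Proof.
have truncE n y i : c0_val (c0_truncation n y) i = if (i < n)%N then y i else 0 by [].
have subE (x z : X) i : c0_val (x - z) i = c0_val x i - c0_val z i by [].
split.
- by move=> a x y.
- exact: val_inj.
- by [].
- move=> n x; apply/eqP; rewrite eq_le; apply/andP; split.
    apply: c0_norm_le => [|i]; first by rewrite le_max rnorm_ge0.
    have := c0_coord_le (c0_truncation n x) i.
    have := c0_coord_le (x - c0_truncation n x) i.
    rewrite le_max subE truncE; case: ifP => _; last by rewrite subr0 => -> _; rewrite orbT.
    by move=> _ ->.
  by rewrite ge_max; apply/andP; split; apply: c0_norm_le; rewrite ?rnorm_ge0// => i;
    rewrite ?subE truncE; case: ifP => _; rewrite ?subrr ?subr0 ?rnorm0 ?rnorm_ge0// c0_coord_le.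
- move=> a a' b b' _ aa _ bb.
  by rewrite ge_max !le_max aa bb orbT.
- exact: c0_coord_le.
- move=> n y d yd d0; apply: c0_norm_le => [|i]; first by rewrite mulr_ge0.
  rewrite truncE; case: ifP => [ni|_]; last by rewrite rnorm0 mulr_ge0.
  by rewrite (le_trans (yd _ ni))// ler_peMl// ler1n (leq_ltn_trans _ ni).
- move=> x e e0; have /c0_predP/(_ _ e0)[n xn] := c0_prop x.
  exists n; apply: c0_norm_le => [|i]; first exact: ltW.
  rewrite subE truncE; case: ltnP => ni; first by rewrite subrr rnorm0 ltW.
  by rewrite subr0 xn.
- move=> y H; suff yc : y \in @c0_pred R k F by exists (C0Sum yc).
  apply/c0_predP => e /H[n nH]; exists n => i ni.
  have := c0_coord_le (c0_truncation i.+1 y - c0_truncation n y) i.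
  rewrite subE !truncE ltnSn ltnNge ni subr0 => /le_trans; apply.
  by apply: nH; exact: leqW.
(* any positive number of unit blocks has norm at most 1 *)
- exists (fun n => (0 < n)%N%:R); first by split=> // -[|n]; rewrite ?ler01 ?maxxx ?(max_r ler01).
  move=> e e0; have [n en] := exists_nat_gt (e^-1 : R); exists n.
  have n0 : (0 < n)%N by rewrite -(ltr0n R) (lt_trans _ en)// invr_gt0.
  by rewrite n0 -ltr_pdivrMr// div1r.
Qed.

End c0_decomposition.

Theorem mainTheorem1 (R : realType) (k : scalar_kind)
    (F : nat -> completeNormedModType (scalars R k))
    (F_fin : forall i, finite_dimensional (F i))
    (p : R) (p1 : 1 < p) :
  (forall nX1 : (0 < numerical_index (lp_sum p1 F))%E, M_ideal (Kv nX1)) /\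
  (forall nX2 : (0 < numerical_index (c0_sum F))%E, M_ideal (Kv nX2)).
Proof.
split=> nX.
  exact: (decomposition_M_ideal (lp_decomposition p1 F) F_fin nX).
exact: (decomposition_M_ideal (c0_decomposition F) F_fin nX).
Qed.
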